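(* For every $e\in\mathbb{N}$ that is of the form $e=\phi(n)/2$ for some $n\in\mathbb{N}\setminus\{1,2\}$, there is a finite set $N_e\subset\mathbb{Q}$ such that, for all $n\in\mathbb{N}\setminus\{1,2\}$ with $\phi(n)/2=e$ and all sets $U\subset\mathbb{S}^1$ of four pairwise non-parallel $\mathcal{O}_n$-directions, the following holds: if $U$ has the property that the cross ratio of slopes of the directions of $U$, arranged in order of increasing angle with the positive real axis, does not map under the norm $N_{\mathbb{k}_n/\mathbb{Q}}$ to $N_e$, then, for all cyclotomic model sets $\Lambda_n(t,W)\in\mathcal{M}(\mathcal{O}_n)$, the set $\mathcal{C}(\Lambda_n(t,W))$ is determined by the $X$-rays in the directions of $U$.
   Context: Identify $\mathbb{C}$ with $\mathbb{R}^2$. Let $\zeta_n=e^{2\pi i/n}$, $\mathbb{K}_n=\mathbb{Q}(\zeta_n)$, $\mathbb{k}_n=\mathbb{Q}(\zeta_n+\bar\zeta_n)$ (the maximal real subfield of $\mathbb{K}_n$, of degree $\phi(n)/2$ over $\mathbb{Q}$), $\mathcal{O}_n=\mathbb{Z}[\zeta_n]$, $\phi$ Euler's totient function, and $N_{\mathbb{k}_n/\mathbb{Q}}$ the field norm. Cyclotomic model sets. For $n\in\mathbb{N}\setminus\{1,2\}$, choose exactly one automorphism from each pair of complex conjugate automorphisms in $\mathrm{Gal}(\mathbb{K}_n/\mathbb{Q})$, obtaining $\sigma_1=\mathrm{id},\sigma_2,\dots,\sigma_{\phi(n)/2}$. The associated star map $\star:\mathcal{O}_n\to(\mathbb{R}^2)^{\phi(n)/2-1}$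 is $z\mapsto(\sigma_2(z),\dots,\sigma_{\phi(n)/2}(z))$; if $n\in\{3,4,6\}$, $(\mathbb{R}^2)^{0}$ is the trivial group $\{0\}$ and the star map is $0$. A window is a set $W\subset(\mathbb{R}^2)^{\phi(n)/2-1}$ with $\varnothing\neq W^\circ\subset W\subset\overline{W^\circ}$ and $\overline{W^\circ}$ compact. For a window $W$ and $t\in\mathbb{R}^2$ set $\Lambda_n(t,W)=t+\{z\in\mathcal{O}_n : z^\star\in W\}$. $\mathcal{M}(\mathcal{O}_n)$ is the collection of all sets $\Lambda_n(t,W)$ (all $t$, all windows $W$, all choices of star map); its elements are called cyclotomic model sets. Directions and X-rays. A direction is an element of the unit circle $\mathbb{S}^1$; an $\mathcal{O}_n$-direction is a direction parallel to a non-zero element of $\mathcal{O}_n$. For a finite $F\subset\mathbb{R}^2$ and a direction $u$, the $X$-ray $X_uF$ is the function assigning to each line $\ell$ parallel to $u$ the number $\operatorname{card}(F\cap\ell)$. A collection $\mathcal{E}$ of finite subsets of $\mathbb{R}^2$ is determined by the $X$-rays in the directions of a finite set $U$ of directions if for all $F,F'\in\mathcal{E}$: $(X_uF=X_uF'\ \forall u\in U)\Rightarrow F=F'$. Convex sets. For $S\subset\mathbb{R}^2$, $\mathcal{C}(S)$ is the set of all finite $C\subset S$ with $C=\operatorname{conv}(C)\cap S$. Cross ratios. The slope of $u=(x,y)$ is $y/x\in\mathbb{R}\cup\{\infty\}$. The cross ratio of an ordered tuple of four distinct elements of $\mathbb{R}\cup\{\infty\}$ is $(t_1,t_2;t_3,t_4)=\frac{(t_3-t_1)(t_4-t_2)}{(t_3-t_2)(t_4-t_1)}$,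 with the usual conventions if some $t_i=\infty$. The angle between a direction $u$ and the positive real axis is the unique $\theta\in[0,\pi)$ such that $e^{i\theta}$ is parallel to $u$. The cross ratio of slopes of four pairwise non-parallel $\mathcal{O}_n$-directions always lies in $\mathbb{k}_n$, so the norm is applicable to it. *)

(* Defs.v *)
From HB Require Import structures.
From mathcomp Require Import all_boot all_order all_algebra all_fingroup.
From mathcomp Require Import all_solvable all_field finmap.
From mathcomp Require Import all_classical all_reals all_analysis complex.

Set Implicit Arguments.
Unset Strict Implicit.
Unset Printing Implicit Defensive.

Import Order.TTheory GRing.Theory Num.Theory.
Import numFieldNormedType.Exports.

Local Open Scope classical_set_scope.
Local Open Scope ring_scope.
Local Open Scope complex_scope.

(* The plane R^2 is identified with R[i]. *)

Section Plane.
Context {R : realType}.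
Implicit Types (u v p : R[i]) (F S l : set R[i]) (U : {fset R[i]}).

Definition cis (x : R) : R[i] := cos x +i* sin x.

Definition parallel u v : Prop := exists2 r : R, r != 0 & v = r%:C * u.

Definition direction u : Prop := `|u| = 1.

Definition lines_parallel_to u : set (set R[i]) :=
  [set l | exists p, l = [set p + s%:C * u | s in [set: R]]].

(* [xray F l] is the value of the X-ray at the line [l]; fixing the direction
   amounts to restricting [l] to [lines_parallel_to u]. *)
Definition xray F l : nat := #|` fset_set (F `&` l)|.

Definition eq_xray u F F' : Prop :=
  forall l, lines_parallel_to u l -> xray F l = xray F' l.

Definition determined_by_xrays (E : set (set R[i])) U : Prop :=
  forall F F', E F -> E F' -> (forall u, u \in U -> eq_xray u F F') -> F = F'.

(* [Rcomplex R] is [R[i]] seen as a real vector space. *)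
Definition conv_hull F : set R[i] :=
  smallest (convex_set (M := Rcomplex R)) F.

Definition convex_subsets S : set (set R[i]) :=
  [set C | [/\ finite_set C, C `<=` S & C = conv_hull C `&` S]].

(* [None] is the point at infinity. *)
Definition slope u : option R :=
  if complex.Re u == 0 then None else Some (complex.Im u / complex.Re u).

(* With the convention that the two factors involving an infinite argument
   cancel; the last case, where at least two arguments are infinite, is junk. *)
Definition cross_ratio (t1 t2 t3 t4 : option R) : R :=
  match t1, t2, t3, t4 with
  | Some a, Some b, Some c, Some d =>
      ((c - a) * (d - b)) / ((c - b) * (d - a))
  | None, Some b, Some c, Some d => (d - b) / (c - b)
  | Some a, None, Some c, Some d => (c - a) / (d - a)
  | Some a, Some b, None, Some d => (d - b) / (d - a)
  | Some a, Some b, Some c, None => (c - a) / (c - b)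
  | _, _, _, _ => 0
  end.

Definition angle u : R :=
  xget 0 [set x | 0 <= x < pi /\ parallel (cis x) u].

Definition cross_ratio_of_slopes U : R :=
  let s := sort (fun u v => angle u <= angle v) U in
  cross_ratio (slope s`_0) (slope s`_1) (slope s`_2) (slope s`_3).

End Plane.

Definition zeta (R : realType) (n : nat) : R[i] := cis (2 * pi / n%:R).

(* A realization of Q(zeta_n) as a field extension of rat together with its
   embedding into R[i]; it is unique up to unique isomorphism, and it exists by
   [cyclotomicField_exists] below. *)
Record cyclotomicField (R : realType) (n : nat) := CyclotomicField {
  cyc_field :> splittingFieldType rat;
  cyc_emb : {rmorphism cyc_field -> R[i]};
  cyc_gen : cyc_field;
  cyc_emb_gen : cyc_emb cyc_gen = zeta R n;
  cyc_gen_full : <<1; cyc_gen>>%VS = fullv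
}.

Arguments cyc_emb {R n} c.
Arguments cyc_gen {R n} c.

Lemma cisX (R : realType) (x : R) k : cis x ^+ k = cis (x *+ k).
Proof.
elim: k => [|k IH]; first by rewrite expr0 mulr0n /cis cos0 sin0.
rewrite exprSr IH mulrSr /cis cosD sinD; simpc.
by congr (_ +i* _); rewrite addrC.
Qed.

Lemma zeta_unity (R : realType) n : (0 < n)%N -> zeta R n ^+ n = 1.
Proof.
move=> n0; rewrite /zeta cisX -[_ *+ n]mulr_natr divfK ?pnatr_eq0 -?lt0n //.
by rewrite mulr_natl /cis cos2pi sin2pi.
Qed.

Lemma cyclotomicField_exists (R : realType) n :
  (0 < n)%N -> inhabited (cyclotomicField R n).
Proof.
move=> n0; pose z := zeta R n.
pose QC : {rmorphism rat -> R[i]} := ratr.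
pose P d := `[< exists p : {poly rat},
  [/\ p != 0, root (map_poly QC p) z & size p = d] >].
have exP : exists d, P d.
  exists (size ('X^n - 1 : {poly rat})); apply/asboolP; exists ('X^n - 1).
  split=> //; first by rewrite -size_poly_eq0 size_XnsubC.
  by rewrite rmorphB rmorph1 /= map_polyXn rootE !hornerE zeta_unity ?subrr.
case: (ex_minnP exP) => d /asboolP[p [nz_p pz0 <-]] min_p.
have irr_p : irreducible_poly p.
  apply/(subfx_irreducibleP pz0 nz_p) => q qz0 nzq.
  by apply: min_p; apply/asboolP; exists q.
pose L : fieldExtType rat := SubFieldExtType pz0 irr_p.
pose iota : {rmorphism L -> R[i]} := @subfx_inj _ _ QC z p.
pose w : L := subfx_root QC z p.
have iw : iota w = z by apply: subfx_inj_root.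
have genL : <<1; w>>%VS = fullv.
  apply/vspaceP => x; rewrite memvf.
  have [q ->] := subfxEroot pz0 nz_p x.
  by apply: mempx_Fadjoin; apply/polyOverP => i; rewrite coef_map memvZ ?mem1v.
have wn : w ^+ n = 1.
  by apply: (fmorph_inj iota); rewrite rmorphXn rmorph1 /= iw zeta_unity.
have [m prim_w _] := prim_order_exists n0 wn.
have splitL : splitting_field_axiom L.
  exists ('X^m - 1); first by rewrite rpredB ?rpred1 ?rpredX ?polyOverX.
  exists [seq w ^+ i | i <- index_iota 0 m].
    by rewrite big_map (factor_Xn_sub_1 prim_w) eqpxx.
  apply/eqP; rewrite eqEsubv subvf -genL; apply/FadjoinP; split.
    exact: subv_adjoin_seq.
  have w_in : w \in [seq w ^+ i | i <- index_iota 0 m].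
    apply/mapP; exists (1 %% m)%N; last by rewrite (prim_expr_mod prim_w).
    by rewrite mem_index_iota /= ltn_mod (prim_order_gt0 prim_w).
  exact: seqv_sub_adjoin.
pose splitM := FieldExt_isSplittingField.Build rat L splitL.
pose L' : splittingFieldType rat := HB.pack L splitM.
constructor; exact: (@CyclotomicField R n L' iota w iw genL).
Qed.

Section CyclotomicModelSets.
Context {R : realType} {n : nat} (K : cyclotomicField R n).

Local Notation iota := (cyc_emb K).
Local Notation z := (cyc_gen K).

Definition cyc_int : set K :=
  [set x | exists p : {poly int}, x = (map_poly intr p).[z]].

(* As [iota z] is a root of unity, [iota z^-1] is its complex conjugate. *)
Definition max_real : {subfield K} := <<1; z + z^-1>>%AS.

(* The norm of max_real over Q, for real numbers in the image of max_real
   under [iota]. *)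
Definition max_real_norm (x : R) : rat :=
  xget 0 [set q | exists a : K,
    [/\ a \in max_real, iota a = x%:C & galNorm 1 max_real a = q%:A]].

Definition cyc_direction (u : R[i]) : Prop :=
  direction u /\ exists a : K, [/\ cyc_int a, a != 0 & parallel u (iota a)].

(* phi(n)/2 - 1, the number of automorphisms in the star map *)
Definition star_dim : nat := (totient n)./2.-1.

Definition eq_up_to_conj (s t : gal_of {:K}) : Prop :=
  (forall x, iota (s x) = iota (t x)) \/
  (forall x, iota (s x) = (iota (t x))^*).

(* All elements of [gal_of {:K}] are automorphisms of K over Q. *)
Definition star_choice (s : 'I_star_dim.+1 -> gal_of {:K}) : Prop :=
  s ord0 = 1%g /\ forall t : gal_of {:K}, exists! j, eq_up_to_conj (s j) t.

(* Row i of the matrix is the point sigma_(i+2)(x) of R^2. *)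
Definition star (s : 'I_star_dim.+1 -> gal_of {:K}) (x : K) :
    'M[R]_(star_dim, 2) :=
  \matrix_(i, j) let y := iota (s (lift ord0 i) x) in
    if j == 0 then complex.Re y else complex.Im y.

Definition window (W : set 'M[R]_(star_dim, 2)) : Prop :=
  [/\ W° !=set0, W° `<=` W, W `<=` closure W° & compact (closure W°)].

Definition model_set (s : 'I_star_dim.+1 -> gal_of {:K}) (t : R[i])
    (W : set 'M[R]_(star_dim, 2)) : set R[i] :=
  [set t + iota x | x in [set x | cyc_int x /\ W (star s x)]].

Definition cyclotomic_model_sets : set (set R[i]) :=
  [set L | exists s t W, [/\ star_choice s, window W & L = model_set s t W]].

End CyclotomicModelSets.

(* Main.v *)
Require Import Defs.
From HB Require Import structures.
From mathcomp Require Import all_boot all_order all_algebra all_fingroup.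
From mathcomp Require Import all_solvable all_field finmap.
From mathcomp Require Import all_classical all_reals all_analysis complex.
From mathcomp Require Import ring lra zify.

Set Implicit Arguments.
Unset Strict Implicit.
Unset Printing Implicit Defensive.

Import Order.TTheory GRing.Theory Num.Theory.
Import numFieldNormedType.Exports.

Local Open Scope classical_set_scope.
Local Open Scope ring_scope.
Local Open Scope complex_scope.

(** Why the theorem is true.

    Let F and F' be distinct convex subsets of the same set L with equal
    X-rays in the four directions, and put P = F \ F' and Q = F' \ F. For
    each direction u of U, a line parallel to u meets P and Q in the same
    number of points. Hence P and Q have the same size and, as two of the
    directions are independent, the same centroid o, which lies in both
    convex hulls. Call the points of P and Q coloured. A point z of P is not
    in conv F', a point of Q is not in conv F; with o as origin this says
    that no coloured point is s a + t b with a, b of the other colour, s, t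
    >= 0 and s + t <= 1 ([hull_separated]).

    Enumerate the coloured points counterclockwise around o, and let m be
    the number of colour changes met on a full turn. On a line parallel to u
    the points of P lie on one side of the points of Q, so each coloured
    point is either a right or a left one. Up to the choice of a starting
    point, the turn first meets the right points and then the left points,
    and any two points of different colours which lie on the same side are
    met in the order of their heights over u, upwards on the right and
    downwards on the left ([upper_order], [lower_order],
    [direction_window]). Exchanging the two ends of the lines therefore
    reverses the turn: if z and w have different colours and lie on the same
    line, then the numbers of colour changes up to z and up to w have a sum
    k_u that depends modulo m only on u ([nchanges_reflection],
    [direction_nchanges]).

    Let W(z) be the power of exp (2 pi i / m) whose exponent is the number
    of colour changes up to z, and for every vector v let X(v) be the sum of
    det(v, z) W(z) over all coloured points. For u in U, pairing the points
    of P and Q on each line gives X(u) = t_u * conj X(u) with t_u = exp (2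
    pi i k_u / m). Moreover X is injective ([nonvanishing]): the functional
    det(v, .) is nonnegative on one half-plane and nonpositive on the other,
    so a trigonometric polynomial of degree one in the number of changes,
    vanishing at the two places where the sign switches, has a positive
    scalar product with it; its constant term is harmless because the points
    sum to zero. This is the analogue of the fact that the first Fourier
    component of a convex polygon is a nondegenerate affine image of a
    regular polygon. So the slopes of U are, up to a real projective map,
    the slopes of the X(u), and the cross ratio is
      c = (t1 - t3) (t2 - t4) / ((t2 - t3) (t1 - t4))
    ([fourier_directions], [cross_ratio_unit]).

    It remains to bound the norm of such a number c from the field k_n when
    m is arbitrary. If w is a primitive d-th root of unity and d > 1, then
    (1 - w)^phi(d) differs from Phi_d(1) by a unit of the ring of algebraic
    integers, and Phi_d(1) divides d; thus 1 - w has p-adic valuation at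
    most 1/(p - 1) for every prime p ([valuation_one_sub_root]). A suitable
    power of c is then a rational number times a unit. Taking norms, the
    exponent of p in the norm of c is at most 2 g / (p - 1) in absolute
    value, where g is the number of conjugates of c that enter the norm
    ([logn_galNorm]). Since g <= phi(n) <= 2 e + 1, only finitely many
    primes occur, with bounded exponents, so the norm lies in a finite set
    that depends on e alone ([galNorm_small]). *)

(** * Counting the changes in a sequence of colours *)

Section SignChanges.
Local Open Scope nat_scope.
Variable s : nat -> bool.

Definition nchanges i := \sum_(j < i) (s j != s j.+1).

Lemma nchangesS i : nchanges i.+1 = nchanges i + (s i != s i.+1).
Proof. by rewrite /nchanges big_ord_recr. Qed.

Lemma nchanges_mono i j : i <= j -> nchanges i <= nchanges j.
Proof.
elim: j => [|j IH]; first by rewrite leqn0 => /eqP->.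
by rewrite leq_eqVlt => /predU1P[->//|/IH h]; rewrite nchangesS; lia.
Qed.

Lemma nchanges_const i j : i <= j -> nchanges i = nchanges j -> s i = s j.
Proof.
elim: j => [|j IH]; first by rewrite leqn0 => /eqP->.
rewrite leq_eqVlt => /predU1P[->//|ij]; rewrite nchangesS => e.
have := nchanges_mono (ij : i <= j) => m.
have e1 : nchanges i = nchanges j by lia.
have : (s j != s j.+1) = false by lia.
by rewrite (IH ij e1) => /negbFE/eqP.
Qed.

Lemma nchanges_lt i j : i < j -> s i != s j -> nchanges i < nchanges j.
Proof.
move=> ij; apply: contraNT; rewrite -leqNgt => h.
by rewrite (nchanges_const (ltnW ij)) //; apply/eqP; rewrite eqn_leq h nchanges_mono // ltnW.
Qed.

Lemma nchanges_eq i j : i <= j -> (forall k, i <= k <= j -> s k = s i) -> nchanges j = nchanges i.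
Proof.
elim: j => [|j IH]; first by rewrite leqn0 => /eqP->.
rewrite leq_eqVlt => /predU1P[->//|ij] h; rewrite nchangesS IH //; last by move=> k hk;
  apply: h; lia.
by rewrite !h ?eqxx; lia.
Qed.

Lemma prev_change c i : c <= i -> nchanges c < nchanges i ->
  exists2 j, c <= j < i & s j != s i /\ nchanges i = (nchanges j).+1.
Proof.
elim: i => [|i IH]; first by rewrite leqn0 => /eqP->; rewrite ltnn.
rewrite leq_eqVlt => /predU1P[->|ci]; first by rewrite ltnn.
rewrite nchangesS; case: (eqVneq (s i) (s i.+1)) => [e|ne] /= lt.
  have [|j hj [sj lj]] := IH ci; first by lia.
  by exists j; rewrite -?e; [lia|split=> //; lia].
by exists i; [lia|split=> //; lia].
Qed.

Lemma next_change i d : i <= d -> nchanges i < nchanges d ->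
  exists2 j, i < j <= d & s j != s i /\ nchanges j = (nchanges i).+1.
Proof.
elim: d => [|d IH]; first by rewrite leqn0 => /eqP->; rewrite ltnn.
rewrite leq_eqVlt => /predU1P[->|id]; first by rewrite ltnn.
case: (ltnP (nchanges i) (nchanges d)) => [lt _|ge lt].
  by have [j hj hh] := IH id lt; exists j => //; lia.
have e : nchanges i = nchanges d by apply/eqP; rewrite eqn_leq ge nchanges_mono.
exists d.+1; first lia.
move: lt; rewrite nchangesS (nchanges_const (id : i <= d) e) -e eq_sym.
by case: (s d.+1 == s d) => //=; lia.
Qed.

(** An involution-like relation that reverses the order of differently coloured
    indices maps the changes before [i] to the changes after [j], and there are
    equally many of them. Only indices of different colours need to be
    reversed: within a block of equal colours the order is irrelevant for the
    number of changes. *)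
Lemma nchanges_reflection (c d : nat) (mate : nat -> nat -> Prop) :
  (forall i j, mate i j -> [/\ mate j i, c <= i <= d & s i != s j]) ->
  (forall i, c <= i <= d -> exists j, mate i j) ->
  (forall i1 i j1 j, i1 < i -> s i1 != s i -> mate i1 j1 -> mate i j -> j < j1) ->
  forall i j, mate i j -> nchanges i + nchanges j = nchanges c + nchanges d.
Proof.
move=> mP mE mR i j ij; apply/eqP; rewrite eqn_leq; apply/andP; split.
  elim/ltn_ind: i j ij => i IH j ij.
  have [ji ci sij] := mP _ _ ij; have [_ cj _] := mP _ _ ji.
  have [lt|ge] := ltnP (nchanges c) (nchanges i); last first.
    have h : nchanges j <= nchanges d by apply: nchanges_mono; lia.
    lia.
  (* [i1] is in the block before that of [i], so its mate is beyond that of [i] *)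
  have [|i1 ci1 [si1 li1]] := prev_change _ lt; first by lia.
  have [|j1 ij1] := mE i1; first by lia.
  have [_ _ s1] := mP _ _ ij1.
  have := IH i1 _ _ ij1; have jj1 : j < j1 by apply: (mR i1 i) => //; lia.
  have : nchanges j < nchanges j1.
    by apply: nchanges_lt => //; move: sij s1 si1; case: (s i) (s j) (s i1) (s j1) => [] [] [] [].
  lia.
have [k kd] : exists k, k = d - i by exists (d - i).
elim/ltn_ind: k i j kd ij => k IH i j kd ij.
have [ji ci sij] := mP _ _ ij; have [_ cj _] := mP _ _ ji.
have [lt|ge] := ltnP (nchanges i) (nchanges d); last first.
  have h : nchanges c <= nchanges j by apply: nchanges_mono; lia.
  lia.
have [|i1 ci1 [si1 li1]] := next_change _ lt; first by lia.
have [|j1 ij1] := mE i1; first by lia.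
have [_ _ s1] := mP _ _ ij1.
have := IH (d - i1) _ i1 j1 erefl ij1.
have jj1 : j1 < j by apply: (mR i i1) => //; [lia|rewrite eq_sym].
have : nchanges j1 < nchanges j.
  by apply: nchanges_lt => //; move: sij s1 si1; case: (s i) (s j) (s i1) (s j1) => [] [] [] [].
lia.
Qed.

Lemma nchanges_period N : (forall i, s (i + N) = s i) ->
  forall i, nchanges (i + N) = nchanges i + nchanges N.
Proof.
by move=> sN; elim=> [|i IH]; [rewrite /nchanges big_ord0|rewrite addSn !nchangesS IH -addSn
  !sN; lia].
Qed.

End SignChanges.

(** * Coordinates adapted to a direction *)

Section Plane.
Variable R : realType.
Implicit Types (u z w a b : R[i]).

Definition dot u z : R := complex.Re u * complex.Re z + complex.Im u * complex.Im z.
Definition det u z : R := complex.Re u * complex.Im z - complex.Im u * complex.Re z.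

Lemma dotN u z : dot (- u) z = - dot u z.
Proof. by case: u z => [? ?] [? ?]; rewrite /dot /=; ring. Qed.

Lemma detN u z : det (- u) z = - det u z.
Proof. by case: u z => [? ?] [? ?]; rewrite /det /=; ring. Qed.

Lemma dot_lin u (s t : R) a b : dot u (s%:C * a + t%:C * b) = s * dot u a + t * dot u b.
Proof. by case: u a b => [? ?] [? ?] [? ?]; rewrite /dot /=; ring. Qed.

Lemma det_lin u (s t : R) a b : det u (s%:C * a + t%:C * b) = s * det u a + t * det u b.
Proof. by case: u a b => [? ?] [? ?] [? ?]; rewrite /det /=; ring. Qed.

Lemma sqr_norm_gt0 u : u != 0 -> 0 < complex.Re u ^+ 2 + complex.Im u ^+ 2.
Proof.
case: u => x y; rewrite eq_complex /= negb_and => h.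
by rewrite lt0r addr_ge0 ?sqr_ge0 // paddr_eq0 ?sqr_ge0 // !sqrf_eq0 negb_and h.
Qed.

(** [dot u] and [det u] are the coordinates along and across [u], up to the
    common factor [`|u|]. *)
Lemma coord_inj u z w : u != 0 -> dot u z = dot u w -> det u z = det u w -> z = w.
Proof.
move=> /sqr_norm_gt0; case: u z w => [x y] [z1 z2] [w1 w2]; rewrite /dot /det /=.
set n := _ + _ => n0 e1 e2; congr (_ +i* _).
  apply: (mulfI (lt0r_neq0 n0)); rewrite /n.
  have -> : (x ^+ 2 + y ^+ 2) * z1 = x * (x * z1 + y * z2) - y * (x * z2 - y * z1) by ring.
  by rewrite e1 e2; ring.
apply: (mulfI (lt0r_neq0 n0)); rewrite /n.
have -> : (x ^+ 2 + y ^+ 2) * z2 = y * (x * z1 + y * z2) + x * (x * z2 - y * z1) by ring.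
by rewrite e1 e2; ring.
Qed.

Lemma detB u z w : det u (z - w) = det u z - det u w.
Proof. by case: u z w => [? ?] [? ?] [? ?]; rewrite /det /=; ring. Qed.

Lemma detC u v : det u v = - det v u. Proof. by rewrite /det; ring. Qed.

Lemma det_sum u (s : seq R[i]) : det u (\sum_(z <- s) z) = \sum_(z <- s) det u z.
Proof.
elim: s => [|z s IH]; first by rewrite !big_nil /det /= !mulr0 subrr.
by rewrite !big_cons -IH; case: u z (\sum_(j <- s) j) {IH} => [? ?] [? ?] [? ?];
  rewrite /det /=; ring.
Qed.

Lemma dot_sum u (s : seq R[i]) : dot u (\sum_(z <- s) z) = \sum_(z <- s) dot u z.
Proof.
elim: s => [|z s IH]; first by rewrite !big_nil /dot /= !mulr0 addr0.
by rewrite !big_cons -IH; case: u z (\sum_(j <- s) j) {IH} => [? ?] [? ?] [? ?];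
  rewrite /dot /=; ring.
Qed.

Lemma dot_cis (r q th A : R) : dot (r%:C * cis th) (q%:C * cis A) = r * q * cos (A - th).
Proof. by rewrite /dot /cis cosB /=; ring. Qed.

Lemma det_cis (r q th A : R) : det (r%:C * cis th) (q%:C * cis A) = r * q * sin (A - th).
Proof. by rewrite /det /cis sinB /=; ring. Qed.

Lemma polar z : z != 0 -> exists r th, [/\ 0 < r, 0 <= th < 2 * pi & z = r%:C * cis th].
Proof.
move=> /sqr_norm_gt0; case: z => x y /=; set n := _ + _ => n0.
pose r := Num.sqrt n; have r0 : 0 < r by rewrite sqrtr_gt0.
have rn := lt0r_neq0 r0.
have r2 : r ^+ 2 = n by rewrite sqr_sqrtr // ltW.
have c2 : (x / r) ^+ 2 + (y / r) ^+ 2 = 1.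
  by rewrite !expr_div_n -mulrDl r2 -/n divff // lt0r_neq0.
have cb : -1 <= x / r <= 1.
  by rewrite -ler_norml -(ler_pXn2r (ltn0Sn 1)) ?nnegrE // real_normK ?num_real // expr1n -c2
    lerDl sqr_ge0.
have [a1 a2] := acos_def cb.
have sE : sin (acos (x / r)) = `|y / r|.
  rewrite sin_acos // -sqrtr_sqr; congr Num.sqrt.
  by rewrite -c2 addrAC subrr add0r.
have pi0 := pi_gt0 R.
have xE : x = r * (x / r) by rewrite mulrCA divff // mulr1.
have yE : y = r * (y / r) by rewrite mulrCA divff // mulr1.
have [y0|y0] := leP 0 (y / r).
  exists r, (acos (x / r)); split=> //; first by lra.
  by rewrite /cis a2 sE ger0_norm //; simpc; congr (_ +i* _).
exists r, (2 * pi - acos (x / r)); split=> //; last first.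
  rewrite /cis cosB sinB mulr_natl cos2pi sin2pi a2 sE ltr0_norm //; simpc.
  by congr (_ +i* _); [rewrite {1}xE; ring|rewrite {1}yE; ring].
have : 0 < acos (x / r).
  rewrite lt_neqAle (andP a1).1 andbT eq_sym; apply/eqP => e.
  by move: sE y0; rewrite e sin0 => /esym/eqP; rewrite normr_eq0 => /eqP->; rewrite ltxx.
by move=> ?; lra.
Qed.

Lemma cis_conj (x : R) : cis x * (cis x)^* = 1.
Proof.
rewrite /cis; simpc; rewrite -!expr2 cos2Dsin2; congr (_ +i* _); ring.
Qed.

End Plane.

(** * Left and right points of a line *)

Section TwoColours.
Variable R : realType.
Implicit Types (u z w p a b : R[i]).
Variables (Z : seq R[i]) (sg : R[i] -> bool).

(** Seen from the origin, which belongs to the convex hulls of both colours, a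
    point is never inside the hull of the other colour. *)
Definition hull_separated := forall z a b (s t : R), z \in Z -> a \in Z -> b \in Z ->
  sg a != sg z -> sg b != sg z -> 0 <= s -> 0 <= t -> s + t <= 1 ->
  z <> s%:C * a + t%:C * b.

Definition mated u := forall z, z \in Z ->
  exists w, [/\ w \in Z, sg w != sg z & det u w = det u z].

(** A point is right when it follows a point of the other colour on its line
    parallel to [u]; by [is_rightP] it then follows all of them. *)
Definition is_right u z :=
  has (fun w => [&& sg w != sg z, det u w == det u z & dot u w < dot u z]) Z.

Hypothesis Zsep : hull_separated.

(** A point cannot lie between two points of the other colour, so comparing it
    with any single one of them decides its side. *)
Lemma is_rightP u z w : u != 0 -> z \in Z -> w \in Z -> sg w != sg z -> det u w = det u z ->
  is_right u z = (dot u w < dot u z).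
Proof.
move=> u0 zZ wZ sw hw; apply/idP/idP; last first.
  by move=> lt; apply/hasP; exists w => //; rewrite sw hw eqxx.
move=> /hasP[a aZ /and3P[sa /eqP ha lta]]; rewrite ltNge; apply/negP => le.
have d0 : 0 < dot u w - dot u a by rewrite subr_gt0; apply: lt_le_trans le.
pose s := (dot u w - dot u z) / (dot u w - dot u a).
pose t := (dot u z - dot u a) / (dot u w - dot u a).
have st : s + t = 1 by rewrite /s /t; field; exact: lt0r_neq0.
apply: (Zsep zZ aZ wZ sa sw (_ : 0 <= s) (_ : 0 <= t)).
- by rewrite divr_ge0 ?subr_ge0 // ltW // -subr_gt0.
- by rewrite divr_ge0 ?subr_ge0 ?(ltW lta) // ltW // -subr_gt0.
- by rewrite st.
- apply: (coord_inj u0); rewrite ?dot_lin ?det_lin.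
    by rewrite /s /t; field; exact: lt0r_neq0.
  by rewrite ha hw -mulrDl st mul1r.
Qed.

Lemma dot_neq u z w : u != 0 -> z \in Z -> w \in Z -> sg w != sg z -> det u w = det u z ->
  dot u w != dot u z.
Proof.
move=> u0 zZ wZ sw hw; apply/eqP => e.
apply: (Zsep zZ wZ wZ sw sw (ler01 : 0 <= 1 :> R) (lexx 0)); first by rewrite addr0.
by rewrite mul0r addr0 mul1r; apply: (coord_inj u0).
Qed.

Lemma is_rightN u z : u != 0 -> mated u -> z \in Z -> is_right (- u) z = ~~ is_right u z.
Proof.
move=> u0 mu zZ; have [w [wZ sw hw]] := mu z zZ.
have hw' : det (- u) w = det (- u) z by rewrite !detN hw.
rewrite (is_rightP u0 zZ wZ sw hw) (is_rightP _ zZ wZ sw hw') ?oppr_eq0 //.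
by rewrite !dotN ltrN2 -leNgt lt_neqAle eq_sym dot_neq.
Qed.

(** If [p] is the lowest of three points above the axis and [a], [p], [b] occur
    in this angular order, then the segment from [a] to [b] passes beyond [p],
    which puts [p] inside the triangle spanned by the origin, [a] and [b]. The
    solution of [p = s a + t b] by Cramer's rule fails only if the three points
    are on one ray. *)
Lemma wedge u p a b : u != 0 -> p \in Z -> a \in Z -> b \in Z ->
  sg a != sg p -> sg b != sg p ->
  0 < det u p -> det u p <= det u a -> det u p <= det u b ->
  dot u p * det u a <= dot u a * det u p ->
  dot u b * det u p <= dot u p * det u b -> False.
Proof.
move=> u0 pZ aZ bZ sa sb hp pa pb.
set xp := dot u p; set xa := dot u a; set xb := dot u b.
move: hp pa pb; set hp := det u p; set ha := det u a; set hb := det u b.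
move=> p0 pa pb ap pb'.
have a0 := lt_le_trans p0 pa; have b0 := lt_le_trans p0 pb.
pose D := xa * hb - xb * ha.
have DE : hp * D = ha * (xp * hb - xb * hp) + hb * (xa * hp - xp * ha) by rewrite /D; ring.
have g1 : 0 <= xp * hb - xb * hp by rewrite subr_ge0.
have g2 : 0 <= xa * hp - xp * ha by rewrite subr_ge0.
have [D0|D0] := ltP 0 D.
  pose s := (xp * hb - xb * hp) / D; pose t := (xa * hp - xp * ha) / D.
  have s0 : 0 <= s by rewrite divr_ge0 // ltW.
  have t0 : 0 <= t by rewrite divr_ge0 // ltW.
  have nD := lt0r_neq0 D0.
  have hE : hp = s * ha + t * hb by rewrite /s /t; rewrite /D in nD *; field.
  have xE : xp = s * xa + t * xb by rewrite /s /t; rewrite /D in nD *; field.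
  apply: (Zsep pZ aZ bZ sa sb s0 t0); last first.
    by apply: (coord_inj u0); rewrite ?dot_lin ?det_lin.
  rewrite -(ler_pM2r p0) mul1r mulrDl {3}hE.
  by apply: lerD; rewrite ler_wpM2l.
have z2 : xa * hp - xp * ha = 0.
  apply/eqP; rewrite eq_le g2 andbT -(pmulr_rle0 _ b0).
  have := mulr_ge0 (ltW a0) g1; have : hp * D <= 0 by rewrite pmulr_rle0.
  lra.
pose s := hp / ha.
have s1 : s <= 1 by rewrite ler_pdivrMr // mul1r.
apply: (Zsep pZ aZ aZ sa sa (_ : 0 <= s) (lexx 0)); rewrite ?addr0 //.
  by rewrite divr_ge0 // ltW.
have na := lt0r_neq0 a0.
apply: (coord_inj u0); rewrite ?dot_lin ?det_lin mul0r addr0 -/xp -/xa -/hp -/ha /s;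
  last by field.
by apply: (mulIf na); rewrite mulrAC divfK //; lra.
Qed.

(** In each case a wrong order would put the lower one of [z] and [w] into a
    triangle with vertices of the other colour: the vertices are its own mate
    on its line, and either the other point or the mate of that point. *)
Lemma upper_order u z w : u != 0 -> mated u -> z \in Z -> w \in Z ->
  0 < det u z -> 0 < det u w -> dot u w * det u z <= dot u z * det u w ->
  [/\ is_right u w -> is_right u z,
      is_right u z -> is_right u w -> sg z != sg w -> det u z < det u w &
      ~~ is_right u z -> ~~ is_right u w -> sg z != sg w -> det u w < det u z].
Proof.
move=> u0 mu zZ wZ hz hw D.
have [z' [z'Z sz hz']] := mu z zZ; have [w' [w'Z sw hw']] := mu w wZ.
have swap x y : sg x != sg y -> sg y != sg x by rewrite eq_sym.
have rz := is_rightP u0 zZ z'Z sz hz'; have rw := is_rightP u0 wZ w'Z sw hw'.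
have nz := dot_neq u0 zZ z'Z sz hz'; have nw := dot_neq u0 wZ w'Z sw hw'.
rewrite rz rw; split.
- move=> rt; rewrite ltNge; apply/negP; rewrite le_eqVlt => /predU1P[e|lt].
    by rewrite -e eqxx in nz.
  have le1 : dot u z * det u w <= dot u z' * det u w by rewrite ler_wpM2r // ltW.
  have le2 : dot u w' * det u z <= dot u w * det u z by rewrite ler_wpM2r // ltW.
  have le3 : dot u z * det u z <= dot u z' * det u z by rewrite ler_wpM2r // ltW.
  have le4 : dot u w' * det u w <= dot u w * det u w by rewrite ler_wpM2r // ltW.
  have [e|ne] := eqVneq (sg z) (sg w).
    have sz2 : sg z' != sg w by rewrite -e.
    have sw2 : sg w' != sg z by rewrite e.
    have [le|/ltW le] := leP (det u z) (det u w).
      by apply: (@wedge u z z' w'); rewrite ?hz' ?hw' //; lra.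
    by apply: (@wedge u w z' w'); rewrite ?hz' ?hw' //; lra.
  have [le|/ltW le] := leP (det u z) (det u w).
  + by apply: (@wedge u z z' w); rewrite ?hz' ?hw' 1?(eq_sym (sg w)) //; lra.
  + by apply: (@wedge u w z w'); rewrite ?hz' ?hw' //; lra.
- move=> rt1 rt2 ne; rewrite ltNge; apply/negP => le.
  have le4 : dot u w' * det u w <= dot u w * det u w by rewrite ler_wpM2r // ltW.
  by apply: (@wedge u w z w'); rewrite ?hz' ?hw' //; lra.
- rewrite -!leNgt => rt1 rt2 ne; rewrite ltNge; apply/negP => le.
  have le3 : dot u z * det u z <= dot u z' * det u z by rewrite ler_wpM2r // ltW.
  by apply: (@wedge u z z' w); rewrite ?hz' ?hw' 1?(eq_sym (sg w)) //; lra.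
Qed.

Lemma mated_opp u : mated u -> mated (- u).
Proof.
by move=> mu z zZ; have [w [wZ sw hw]] := mu z zZ; exists w; rewrite !detN hw.
Qed.

(** Turning the plane by a half-turn, that is replacing [u] by [- u], exchanges
    left and right and the two half-planes. *)
Lemma lower_order u z w : u != 0 -> mated u -> z \in Z -> w \in Z ->
  det u z < 0 -> det u w < 0 -> dot u w * det u z <= dot u z * det u w ->
  [/\ is_right u z -> is_right u w,
      is_right u z -> is_right u w -> sg z != sg w -> det u z < det u w &
      ~~ is_right u z -> ~~ is_right u w -> sg z != sg w -> det u w < det u z].
Proof.
move=> u0 mu zZ wZ hz hw D.
have := @upper_order (- u) z w; rewrite !is_rightN // !dotN !detN !oppr_gt0 !ltrN2 !mulrNN.
rewrite oppr_eq0 => /(_ u0 (mated_opp mu) zZ wZ hz hw D)[h1 h2 h3].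
split; [|by move=> *; apply: h3; rewrite ?negbK|by []].
by move=> rz; apply: contraTT rz.
Qed.

(** On the line through the origin the two colours are on opposite sides of the
    origin, because two points of a ray have the same colour. *)
Lemma axis_side u z : u != 0 -> mated u -> z \in Z -> det u z = 0 -> is_right u z = (0 < dot u z).
Proof.
move=> u0 mu zZ hz; have [w [wZ sw hw]] := mu z zZ.
rewrite (is_rightP u0 zZ wZ sw hw).
have ray s : 0 <= s -> s <= 1 -> dot u z = s * dot u w -> False.
  move=> s0 s1 e; apply: (Zsep zZ wZ wZ sw sw s0 (lexx 0)); first by rewrite addr0.
  by apply: (coord_inj u0); rewrite ?dot_lin ?det_lin ?hw ?hz mul0r addr0 ?mulr0.
have [z0|z0] := ltP 0 (dot u z).
  rewrite ltNge; apply/negP => le; have w0 := lt_le_trans z0 le.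
  apply: (ray (dot u z / dot u w)).
  - by rewrite divr_ge0 // ltW.
  - by rewrite ler_pdivrMr // mul1r.
  - by rewrite divfK // lt0r_neq0.
apply/negP => lt; have w0 := lt_le_trans lt z0.
apply: (ray (dot u z / dot u w)).
- by rewrite mulr_le0 // invr_le0 ltW.
- by rewrite ler_ndivrMr // mul1r ltW.
- by rewrite divfK // ltr0_neq0.
Qed.

End TwoColours.

(** * Enumeration of the points by their angle *)

Section Angular.
Variable R : realType.
Implicit Types (u z w : R[i]).

(** The points of [Z], listed counterclockwise and continued periodically
    together with a continuous choice [A] of their angles. Starting the turn at
    another point then amounts to taking another window of [N] consecutive
    indices. *)
Definition angular_enumeration (Z : seq R[i]) N (pt : nat -> R[i]) (A : nat -> R) : Prop :=
  [/\ [/\ (0 < N)%N, 0 <= A 0 & A 0 < 2 * pi], perm_eq (map pt (iota 0 N)) Z,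
      forall i, pt (i + N)%N = pt i /\ A (i + N)%N = A i + 2 * pi,
      {homo A : i j / (i <= j)%N >-> i <= j} &
      forall i, exists2 r, 0 < r & pt i = r%:C * cis (A i)].

Definition argument z : R :=
  xget 0 [set th | 0 <= th < 2 * pi /\ exists2 r, 0 < r & z = r%:C * cis th].

Lemma argumentP z : z != 0 ->
  0 <= argument z < 2 * pi /\ exists2 r, 0 < r & z = r%:C * cis (argument z).
Proof.
move=> z0; rewrite /argument; case: xgetP => [y _ //|h].
by have [r [th [r0 thb zE]]] := polar z0; exfalso; apply: (h th); split=> //; exists r.
Qed.

Lemma angular_exists (Z : seq R[i]) : (0 < size Z)%N -> 0 \notin Z ->
  exists pt A, angular_enumeration Z (size Z) pt A.
Proof.
set N := size Z => N0 Z0.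
pose le := relpre argument <=%R.
pose s := sort le Z.
have szs : size s = N by rewrite size_sort.
have ltot : total le by move=> x y; exact: le_total.
have ltr : transitive le by move=> x y z; exact: le_trans.
have lrefl : reflexive le by move=> x; exact: lexx.
pose pt i := nth 0 s (i %% N).
have ptZ i : pt i \in Z by rewrite -(mem_sort le) mem_nth // szs ltn_mod.
have pt0 i : pt i != 0 by apply: contraNneq Z0 => <-.
exists pt, (fun i => argument (pt i) + 2 * pi * (i %/ N)%:R); split.
- have [/andP[h1 h2] _] := argumentP (pt0 0%N).
  by rewrite div0n mulr0 addr0.
- suff -> : map pt (iota 0 N) = s by rewrite perm_sort.
  apply: (@eq_from_nth _ 0) => [|i]; rewrite size_map size_iota // => iN.
  by rewrite (nth_map 0%N) ?size_iota // nth_iota // add0n /pt modn_small.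
- move=> i; rewrite /pt modnDr divnDr ?dvdnn // divnn N0 natrD; split=> //.
  by rewrite mulrDr mulr1 addrA.
- move=> i j ij; have [e|lt] := eqVneq (i %/ N)%N (j %/ N)%N.
    rewrite e lerD2r; apply: (sorted_leq_nth ltr lrefl 0 (sort_sorted ltot Z));
      rewrite ?inE ?szs ?ltn_mod //.
    by move: ij; rewrite {1}(divn_eq i N) {1}(divn_eq j N) e leq_add2l.
  have {}lt : (i %/ N < j %/ N)%N by rewrite ltn_neqAle lt leq_div2r.
  have [/andP[h1 h2] _] := argumentP (pt0 i).
  have [/andP[h3 h4] _] := argumentP (pt0 j).
  have pi0 := pi_gt0 R.
  have : 2 * pi * ((i %/ N).+1%:R) <= 2 * pi * ((j %/ N)%:R) :> R.
    by rewrite ler_wpM2l ?ler_nat //; lra.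
  by rewrite -[(i %/ N).+1%:R]natr1 (mulrDr (2 * pi)) mulr1; lra.
- move=> i; have [_ [r r0 e]] := argumentP (pt0 i); exists r => //.
  rewrite {1}e; congr (_ * _); rewrite /cis; elim: (i %/ N)%N => [|k IH];
    first by rewrite mulr0 addr0.
  have -> : argument (pt i) + 2 * pi * k.+1%:R = argument (pt i) + 2 * pi * k%:R + pi *+ 2.
    by rewrite -[k.+1%:R]natr1; ring.
  by rewrite IH cosD2pi sinD2pi.
Qed.

Section Fixed.
Variables (Z : seq R[i]) (sg : R[i] -> bool) (N : nat) (pt : nat -> R[i]) (A : nat -> R).
Hypothesis Zsep : hull_separated Z sg.
Hypothesis ang : angular_enumeration Z N pt A.

Let N0 : (0 < N)%N. Proof. by case: ang => -[]. Qed.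
Let A0ge : 0 <= A 0. Proof. by case: ang => -[]. Qed.
Let A0lt : A 0 < 2 * pi. Proof. by case: ang => -[]. Qed.
Let ptN i : pt (i + N)%N = pt i. Proof. by case: ang => _ _ /(_ i)[]. Qed.
Let AN i : A (i + N)%N = A i + 2 * pi. Proof. by case: ang => _ _ /(_ i)[]. Qed.
Let Amono i j : (i <= j)%N -> A i <= A j. Proof. by case: ang => _ _ _ h _; exact: h. Qed.
Let ptE i : exists2 r, 0 < r & pt i = r%:C * cis (A i). Proof. by case: ang => _ _ _ _;
  exact. Qed.
Let pi0 : 0 < pi :> R := pi_gt0 R.

Lemma ptNk i k : pt (i + k * N)%N = pt i.
Proof. by elim: k => [|k IH]; rewrite ?addn0 // mulSn addnCA addnC ptN. Qed.

Lemma shift_window c i : exists i' k, [/\ (c <= i' < c + N)%N, pt i' = pt i &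
  (i' = i + k * N \/ i = i' + k * N)%N].
Proof.
have [lt|ge] := ltnP i c.
  exists (i + ((c - i + N.-1) %/ N) * N)%N, ((c - i + N.-1) %/ N)%N; rewrite ptNk;
    split=> //; last by left.
  have := divn_eq (c - i + N.-1) N; have := ltn_pmod (c - i + N.-1) N0.
  lia.
exists (c + (i - c) %% N)%N, ((i - c) %/ N)%N; split.
- by rewrite leq_addr ltn_add2l ltn_mod.
- rewrite -(ptNk _ ((i - c) %/ N)); congr pt.
  by have := divn_eq (i - c) N; lia.
- by right; have := divn_eq (i - c) N; lia.
Qed.

Lemma pt_mem i : pt i \in Z.
Proof.
have [j [k [/andP[_ jN] <- _]]] := shift_window 0 i.
by case: ang => _ /perm_mem <- _ _ _; apply/mapP; exists j; rewrite // mem_iota.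
Qed.

Lemma mem_pt c z : z \in Z -> exists2 i, (c <= i < c + N)%N & pt i = z.
Proof.
case: ang => _ /perm_mem <- _ _ _ /mapP[j _ ->].
by have [i [k [ic e _]]] := shift_window c j; exists i.
Qed.

(** A ray cuts the enumeration into windows of one turn each. Angles from
    [2 * pi] on suffice, and they leave room for an index before the cut. *)
Lemma angular_cut (th : R) : 2 * pi <= th -> exists b, [/\ (0 < b)%N, forall i,
  (b <= i)%N = (th <= A i) &
   forall i, (i < b + N)%N = (A i < th + 2 * pi)].
Proof.
move=> thp.
have A_kN k : A (k * N)%N = A 0 + 2 * pi * k%:R.
  elim: k => [|k IH]; first by rewrite mulr0 addr0.
  by rewrite mulSn addnC AN IH -[k.+1%:R]natr1; ring.
have ex : exists i, th <= A i.
  exists ((Num.truncn (th / (2 * pi))%R).+1 * N)%N; rewrite A_kN.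
  have := truncnS_gt (th / (2 * pi)); rewrite ltr_pdivrMr; last by move: pi0; lra.
  by rewrite [X in _ < X]mulrC => h; move: (ltW h) A0ge; set k := _ * _%:R; lra.
case: (ex_minnP ex) => b bA bmin.
have b0 : (0 < b)%N.
  by rewrite lt0n; apply: contraTneq bA => ->; rewrite -ltNge; move: A0lt; lra.
have H i : (b <= i)%N = (th <= A i).
  by apply/idP/idP => [bi|/bmin //]; apply: le_trans bA (Amono bi).
exists b; split=> // i.
have [iN|Ni] := ltnP i N.
  have e : A i <= A (0 + N)%N by apply: Amono; rewrite ltnW.
  rewrite AN in e; have h0 : A 0 < th by rewrite ltNge -H -ltnNge.
  have -> : (i < b + N)%N by lia.
  by apply/esym; move: pi0; lra.
have e := AN (i - N); rewrite subnK // in e.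
have := H (i - N)%N; rewrite e.
have -> : (th + 2 * pi > A (i - N)%N + 2 * pi) = ~~ (th <= A (i - N)%N) by rewrite -ltNge ltrD2r.
by move=> <-; rewrite -ltnNge; lia.
Qed.

Lemma same_ray i j : A i = A j -> sg (pt i) = sg (pt j).
Proof.
wlog suff H : i j / forall r q : R, 0 < r -> r <= q -> pt i = r%:C * cis (A i) ->
  pt j = q%:C * cis (A j)
    -> A i = A j -> sg (pt i) = sg (pt j).
  move=> e; have [r r0 ri] := ptE i; have [q q0 qj] := ptE j.
  have [rq|/ltW qr] := leP r q; first exact: (H i j r q).
  by apply/esym/(H j i q r).
move=> r q r0 rq ri qj e; apply/eqP/negPn/negP => ne.
have q0 := lt_le_trans r0 rq.
apply: (Zsep (pt_mem i) (pt_mem j) (pt_mem j) (_ : sg _ != sg _) (_ : sg _ != sg _)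
   (_ : 0 <= r / q) (lexx 0)); rewrite 1?eq_sym ?addr0 //.
- by rewrite divr_ge0 // ltW.
- by rewrite ler_pdivrMr // mul1r.
- rewrite mul0r addr0 ri qj e mulrA -rmorphM /= divfK //; exact: lt0r_neq0.
Qed.

(** The determinant of two points at an angular distance of at most [pi] is
    nonnegative. *)
Lemma det_dot_cross u (r th : R) i j : 0 < r -> u = r%:C * cis th -> 0 <= A j - A i <= pi ->
  dot u (pt j) * det u (pt i) <= dot u (pt i) * det u (pt j).
Proof.
move=> r0 -> dA; have [q q0 ->] := ptE i; have [p p0 ->] := ptE j.
rewrite !dot_cis !det_cis -subr_ge0.
have -> : r * q * cos (A i - th) * (r * p * sin (A j - th)) -
          r * p * cos (A j - th) * (r * q * sin (A i - th)) =
          r * r * q * p * sin ((A j - th) - (A i - th)) by rewrite [sin (_ - (_ - _))]sinB; ring.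
have -> : A j - th - (A i - th) = A j - A i by ring.
by rewrite mulr_ge0 ?sin_ge0_pi // !mulr_ge0 // ltW.
Qed.

(** The enumeration is cut at the first right point [c] that follows the left
    half of the axis of [u]. Around the turn one meets right points below the
    axis, right points above it, left points above it and left points below it.
    The cut need not be at a fixed angle: below the axis the left points come
    before the right ones, but the angle that separates them depends on the
    configuration. *)
Lemma direction_window u : u != 0 -> mated Z sg u -> exists c, [/\ is_right Z sg u (pt c),
  forall i j, (c <= i < j)%N -> (j < c + N)%N ->
    is_right Z sg u (pt j) -> is_right Z sg u (pt i),
  forall i j, (c <= i < j)%N -> (j < c + N)%N -> sg (pt i) != sg (pt j) ->
    is_right Z sg u (pt i) -> is_right Z sg u (pt j) -> det u (pt i) < det u (pt j) &
  forall i j, (c <= i < j)%N -> (j < c + N)%N -> sg (pt i) != sg (pt j) ->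
    ~~ is_right Z sg u (pt i) -> ~~ is_right Z sg u (pt j) -> det u (pt j) < det u (pt i)].
Proof.
move=> u0 mu; have [r [th [r0 thb uE]]] := polar u0.
pose T := th + 3 * pi.
have [|b [b0 bT bN]] := @angular_cut T; first by rewrite /T; move: pi0 thb; lra.
pose rt i := is_right Z sg u (pt i).
pose h i := det u (pt i).
have rtN i : rt (i + N)%N = rt i by rewrite /rt ptN.
have hN i : h (i + N)%N = h i by rewrite /h ptN.
have ex : exists c, (b <= c)%N && rt c.
  have [w [wZ sw hw]] := mu _ (pt_mem b); have [k kb kw] := mem_pt b wZ.
  have [rb|nrb] := boolP (rt b); first by exists b; rewrite leqnn.
  exists k; rewrite (andP kb).1 /rt kw.
  have sw' : sg (pt b) != sg w by rewrite eq_sym.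
  rewrite (is_rightP Zsep u0 wZ (pt_mem b) sw' (esym hw)).
  rewrite lt_neqAle eq_sym (dot_neq Zsep u0 (pt_mem b) wZ sw hw) /=.
  by rewrite leNgt -(is_rightP Zsep u0 (pt_mem b) wZ sw hw).
case: (ex_minnP ex) => c /andP[bc rc] cmin.
have left_before i : (b <= i < c)%N -> ~~ rt i.
  by move=> /andP[bi ic]; apply: contraTN ic => ri; rewrite -leqNgt cmin // bi.
have cbN : (c < b + N)%N.
  rewrite ltnNge; apply/negP => le.
  have Nc : (N <= c)%N by apply: leq_trans le; rewrite leq_addl.
  have NH : (b <= c - N < c)%N by move: N0; clear -Nc le; lia.
  by have := left_before _ NH; rewrite -rtN subnK // rc.
(* the turn from [T] on: left half-axis, lower half-plane, right half-axis,
   upper half-plane *)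
have sector i : (b <= i < b + N)%N ->
  [\/ [/\ A i = T, h i = 0 & ~~ rt i], [/\ T < A i, A i < T + pi & h i < 0],
      [/\ A i = T + pi, h i = 0 & rt i] | [/\ T + pi < A i, A i < T + 2 * pi & 0 < h i]].
  move=> /andP[]; rewrite bT bN => Ti iT.
  have [q q0 pE] := ptE i.
  have rq : 0 < r * q by rewrite mulr_gt0.
  have hE : h i = - (r * q * sin (A i - T)).
    rewrite /h pE uE det_cis; have -> : A i - th = A i - T + pi + pi *+ 2 by rewrite /T; ring.
    by rewrite sinD2pi sinDpi; ring.
  have dE : dot u (pt i) = - (r * q * cos (A i - T)).
    rewrite pE uE dot_cis; have -> : A i - th = A i - T + pi + pi *+ 2 by rewrite /T; ring.
    by rewrite cosD2pi cosDpi; ring.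
  have [e|ne] := eqVneq (A i) T.
    have h0 : h i = 0 by rewrite hE e subrr sin0; ring.
    constructor 1; split=> //.
    rewrite /rt (axis_side Zsep u0 mu (pt_mem i) h0) dE e subrr cos0 mulr1.
    by rewrite oppr_gt0 -leNgt ltW.
  have {Ti ne} Ti : T < A i by rewrite lt_neqAle eq_sym ne.
  have [l1|l1|e] := ltgtP (A i) (T + pi).
  - constructor 2; split=> //; rewrite hE oppr_lt0 mulr_gt0 // sin_gt0_pi //; lra.
  - constructor 4; split=> //; rewrite hE.
    have -> : A i - T = A i - T - pi + pi by ring.
    by rewrite sinDpi mulrN opprK mulr_gt0 // sin_gt0_pi //; move: pi0 iT; lra.
  - have e' : A i - T = pi by rewrite e; ring.
    have h0 : h i = 0 by rewrite hE e' sinpi mulr0 oppr0.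
    constructor 3; split=> //.
    by rewrite /rt (axis_side Zsep u0 mu (pt_mem i) h0) dE e' cospi mulrN mulr1 opprK.
have UO i j : (i <= j)%N -> 0 < h i -> 0 < h j -> A j - A i <= pi ->
    [/\ rt j -> rt i, rt i -> rt j -> sg (pt i) != sg (pt j) -> h i < h j &
        ~~ rt i -> ~~ rt j -> sg (pt i) != sg (pt j) -> h j < h i].
  move=> ij hi hj d; apply: (upper_order Zsep u0 mu (pt_mem i) (pt_mem j) hi hj).
  by apply: (det_dot_cross r0 uE); rewrite subr_ge0 Amono.
have LO i j : (i <= j)%N -> h i < 0 -> h j < 0 -> A j - A i <= pi ->
    [/\ rt i -> rt j, rt i -> rt j -> sg (pt i) != sg (pt j) -> h i < h j &
        ~~ rt i -> ~~ rt j -> sg (pt i) != sg (pt j) -> h j < h i].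
  move=> ij hi hj d; apply: (lower_order Zsep u0 mu (pt_mem i) (pt_mem j) hi hj).
  by apply: (det_dot_cross r0 uE); rewrite subr_ge0 Amono.
have secc : (b <= c < b + N)%N by rewrite bc.
have pi0' := pi0.
have left_up i : (c <= i < b + N)%N -> ~~ rt i -> [/\ T + pi < A i, A i < T + 2 * pi & 0 < h i].
  move=> /andP[ci iN] nri; have Aci := Amono ci.
  have seci : (b <= i < b + N)%N by rewrite iN (leq_trans bc).
  case: (sector i seci) => [[e _ _]|[l1 l2 hi]|[_ _ ri]|[l1 l2 hi]] //; last by rewrite ri in nri.
    case: (sector c secc) => [[_ _ n]|[l1 _ _]|[l1 _ _]|[l1 _ _]];
      first (by rewrite rc in n); exfalso; lra.
  case: (sector c secc) => [[_ _ n]|[l3 _ hc]|[l3 _ _]|[l3 _ _]]; first (by rewrite rc in n);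
    try (exfalso; lra).
  have [] := LO c i ci hc hi; first by lra.
  by move=> /(_ rc) ri; rewrite ri in nri.
have wrap i : (b + N <= i < c + N)%N -> exists2 k, i = (k + N)%N & (b <= k < c)%N.
  by move=> H; exists (i - N)%N; clear -H; lia.
have left_low k : (b <= k < c)%N -> ~~ rt k /\
    ((A k = T /\ h k = 0) \/ [/\ T < A k, A k < T + pi & h k < 0]).
  move=> kc; have nrk := left_before k kc; split=> //.
  have seck : (b <= k < b + N)%N by clear -kc cbN; lia.
  have kc' : (k <= c)%N by clear -kc; lia.
  have Akc := Amono kc'.
  case: (sector k seck) => [[e h0 _]|[l1 l2 hk]|[_ _ rk]|[l1 l2 hk]]; [by left|by right| |].
    by rewrite rk in nrk.
  exfalso.
  case: (sector c secc) => [[e _ _]|[_ l3 _]|[e _ _]|[_ l3 hc]]; try lra.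
  have [] := UO k c kc' hk hc; first by lra.
  by move=> /(_ rc) rk; rewrite rk in nrk.
have right_in i : (c <= i < c + N)%N -> rt i -> (c <= i < b + N)%N.
  move=> /andP[ci iN] ri; rewrite ci ltnNge; apply/negP => le.
  have [|k kE kb] := wrap i; first by rewrite le.
  by have [nk _] := left_low k kb; move: ri; rewrite kE rtN (negPf nk).
have ray i j : A i = A j -> sg (pt i) != sg (pt j) -> False.
  by move=> /same_ray->; rewrite eqxx.
have between i : (c <= i)%N -> (i < b + N)%N -> (b <= i < b + N)%N.
  by move=> ci ->; rewrite (leq_trans bc ci).
exists c; split=> //.
- move=> i j /andP[ci ij] jN; rewrite -!/(rt _) => rj; have Aij := Amono (ltnW ij).
  have cj := leq_trans ci (ltnW ij).
  have [|_ jb] := andP (right_in j _ rj); first by rewrite cj.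
  have ib := ltn_trans ij jb.
  apply/negPn/negP => nri.
  have [|l1 l2 hi] := left_up i _ nri; first by rewrite ci.
  case: (sector j (between j cj jb)) => [[e _ _]|[_ l3 _]|[e _ _]|[_ l3 hj]]; try lra.
  have [] := UO i j (ltnW ij) hi hj; first by lra.
  by move=> /(_ rj) ri; rewrite ri in nri.
- move=> i j /andP[ci ij] jN ne; rewrite -!/(rt _) -!/(h _) => ri rj.
  have Aij := Amono (ltnW ij).
  have cj := leq_trans ci (ltnW ij).
  have [|_ jb] := andP (right_in j _ rj); first by rewrite cj.
  have ib := ltn_trans ij jb.
  case: (sector i (between i ci ib)) => [[_ _ n]|[l1 l2 hi]|[e hi _]|[l1 l2 hi]];
    [by rewrite ri in n| | |];
  (case: (sector j (between j cj jb)) => [[_ _ n]|[l3 l4 hj]|[e' hj _]|[l3 l4 hj]];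
    [by rewrite rj in n| | |]); try lra.
  + have [//|_ + _] := LO i j (ltnW ij) hi hj; first by lra.
    by apply.
  + by exfalso; apply: (ray i j) => //; lra.
  + have [//|_ + _] := UO i j (ltnW ij) hi hj; first by lra.
    by apply.
- move=> i j /andP[ci ij] jN ne; rewrite -!/(rt _) -!/(h _) => ri rj.
  have cj := leq_trans ci (ltnW ij); have iN := ltn_trans ij jN.
  have [ib|bi] := ltnP i (b + N).
    have [|l1 l2 hi] := left_up i _ ri; first by rewrite ci.
    have [jb|bj] := ltnP j (b + N).
      have [|l3 l4 hj] := left_up j _ rj; first by rewrite cj.
      have [//|_ _ +] := UO i j (ltnW ij) hi hj; first by lra.
      by apply.
    have [|k kE kb] := wrap j; first by rewrite bj.
    have [_] := left_low k kb; rewrite kE hN => -[[_ hk]|[_ _ hk]]; first by rewrite hk.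
    exact: lt_trans hi.
  have [|k kE kb] := wrap i; first by rewrite bi.
  have [|l lE lb] := wrap j; first by rewrite (leq_trans bi (ltnW ij)).
  have kl : (k <= l)%N by rewrite -(leq_add2r N) -kE -lE ltnW.
  move: ri rj ne; rewrite kE lE !rtN !ptN !hN => rk rl ne.
  have Akl := Amono kl.
  have [_ Hk] := left_low k kb; have [_ Hl] := left_low l lb.
  case: Hk Hl => [[e hk]|[l1 l2 hk]] [[e' hl]|[l3 l4 hl]]; try lra.
  + by exfalso; apply: (ray k l) => //; lra.
  + have [//|_ _ +] := LO k l kl hk hl; first by lra.
    by apply.
Qed.

Local Notation nch := (nchanges (fun i => sg (pt i))).

Lemma nch_period i k : nch (i + k * N)%N = (nch i + k * nch N)%N.
Proof.
elim: k => [|k IH]; first by rewrite !addn0.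
rewrite mulSn addnCA addnC nchanges_period ?IH //; last by move=> l; rewrite ptN.
by rewrite mulSn addnCA addnC.
Qed.

Lemma shift_nchanges c i : exists i', [/\ (c <= i' < c + N)%N, pt i' = pt i &
  nch i' = nch i %[mod nch N]].
Proof.
have [i' [k [ci' pE kE]]] := shift_window c i; exists i'; split=> //.
by case: kE => ->; rewrite nch_period addnC modnMDl.
Qed.

(** If right points of both colours occur, then the right points contain a
    change [c < i], the left points contain the mirrored change, and two more
    changes occur where the turn passes from one side to the other. *)
Lemma direction_nchanges u : u != 0 -> mated Z sg u ->
  (exists k, forall i j, sg (pt i) != sg (pt j) -> det u (pt i) = det u (pt j) ->
     nch i + nch j = k %[mod nch N]) /\
  ((exists z w, [/\ z \in Z, w \in Z, sg z != sg w, is_right Z sg u z & is_right Z sg u w]) ->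
    (3 < nch N)%N).
Proof.
move=> u0 mu; have [c [rc W1 W2 W3]] := direction_window u0 mu.
pose rt i := is_right Z sg u (pt i).
pose mate i j := [/\ (c <= i < c + N)%N, (c <= j < c + N)%N, sg (pt i) != sg (pt j) &
  det u (pt i) = det u (pt j)].
have mate_sym i j : mate i j -> mate j i.
  by move=> [h1 h2 h3 h4]; split=> //; rewrite eq_sym.
have mate_ex i : (c <= i < c + N)%N -> exists j, mate i j.
  move=> ci; have [w [wZ sw hw]] := mu _ (pt_mem i).
  by have [j cj jE] := mem_pt c wZ; exists j; split; rewrite ?jE // eq_sym.
have rt_mate i j : mate i j -> rt j = ~~ rt i.
  move=> [_ _ ne e]; rewrite /rt (is_rightP Zsep u0 (pt_mem j) (pt_mem i) ne e).
  have ne' : sg (pt j) != sg (pt i) by rewrite eq_sym.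
  rewrite (is_rightP Zsep u0 (pt_mem i) (pt_mem j) ne' (esym e)).
  by rewrite -leNgt lt_neqAle (dot_neq Zsep u0 (pt_mem j) (pt_mem i) ne e).
have reverse i1 i j1 j : (i1 < i)%N -> sg (pt i1) != sg (pt i) -> mate i1 j1 -> mate i j ->
  (j < j1)%N.
  move=> lt ne m1 m; have r1 := rt_mate _ _ m1; have r := rt_mate _ _ m.
  have [/andP[c1 N1] /andP[cj1 Nj1] ne1 e1] := m1; have [/andP[ci Ni] /andP[cj Nj] ne0 e0] := m.
  have nej : sg (pt j1) != sg (pt j).
    by move: ne ne1 ne0; case: (sg (pt i)) (sg (pt i1)) (sg (pt j)) (sg (pt j1)) => [] [] [] [].
  rewrite ltnNge leq_eqVlt; apply/negP => /predU1P[e|lt'].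
    by rewrite e eqxx in nej.
  have ci1 : (c <= i1 < i)%N by rewrite c1.
  have cj1' : (c <= j1 < j)%N by rewrite cj1.
  have A1 := W1 _ _ ci1 Ni; have B1 := W1 _ _ cj1' Nj.
  have A2 := W2 _ _ ci1 Ni ne; have B2 := W2 _ _ cj1' Nj nej.
  have A3 := W3 _ _ ci1 Ni ne; have B3 := W3 _ _ cj1' Nj nej.
  rewrite -!/(rt _) r1 r -e0 -e1 in A1 A2 A3 B1 B2 B3.
  move: A1 A2 A3 B1 B2 B3; case: (rt i1); case: (rt i) => //=.
  - by move=> _ /(_ isT isT) l1 _ _ _ /(_ isT isT) l2; have := lt_trans l1 l2; rewrite ltxx.
  - by move=> _ _ _ /(_ isT).
  - by move=> /(_ isT).
  - by move=> _ _ /(_ isT isT) l1 _ /(_ isT isT) l2 _; have := lt_trans l1 l2; rewrite ltxx.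
split.
  exists (nch c + nch (c + N).-1)%N => i j ne e.
  have [i' [ci' pi' li']] := shift_nchanges c i; have [j' [cj' pj' lj']] := shift_nchanges c j.
  rewrite -modnDm -li' -lj' modnDm; congr modn.
  have toN k : (c <= k <= (c + N).-1)%N = (c <= k < c + N)%N.
    by move: N0; clear; lia.
  apply: (@nchanges_reflection _ _ _ mate); rewrite /mate ?pi' ?pj' //.
  - by move=> k l kl; have [h1 h2 h3 h4] := kl; rewrite toN; split=> //; apply: mate_sym.
  - by move=> k; rewrite toN; apply: mate_ex.
move=> [z [w [zZ wZ zw rz rw]]].
have [y [yZ yc ry]] : exists y, [/\ y \in Z, sg y != sg (pt c) & is_right Z sg u y].
  have [e|ne] := eqVneq (sg z) (sg (pt c)); last by exists z.
  by exists w; split; rewrite // eq_sym -e.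
have [i ci iE] := mem_pt c yZ.
have cc : (c <= c < c + N)%N by rewrite leqnn -[X in (X < _)%N]addn0 ltn_add2l.
have ri : rt i by rewrite /rt iE.
have ne : sg (pt c) != sg (pt i) by rewrite iE eq_sym.
have [c' mc] := mate_ex c cc; have [i' mi] := mate_ex i ci.
have lt1 : (c < i)%N.
  rewrite ltn_neqAle (andP ci).1 andbT; apply: contraNneq ne => ->; exact: eqxx.
have lt3 := reverse _ _ _ _ lt1 ne mc mi.
have [_ /andP[ci' i'N] nei ei] := mi; have [_ /andP[cc' c'N] nec ec] := mc.
have lt2 : (i < i')%N.
  rewrite ltnNge leq_eqVlt; apply/negP => /predU1P[e|lt].
    by rewrite e eqxx in nei.
  have := W1 i' i; rewrite ci' lt (andP ci).2 -!/(rt _) ri => /(_ isT isT isT).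
  by rewrite (rt_mate _ _ mi) ri.
have l1 : (nch c < nch i)%N by apply: nchanges_lt.
have l2 : (nch i < nch i')%N by apply: nchanges_lt.
have l3 : (nch i' < nch c')%N.
  by apply: nchanges_lt => //; move: ne nei nec; case: (sg _) (sg _) (sg _) (sg _) => [] [] [] [].
have l4 : (nch c' < nch (c + N))%N by apply: nchanges_lt; rewrite // ptN eq_sym.
have := nch_period c 1; rewrite !mul1n => l5.
by move: l1 l2 l3 l4; rewrite l5; clear; lia.
Qed.

End Fixed.
End Angular.

(** * Injectivity of the first Fourier coefficient *)

Section Aux.
Variable R : realType.

Lemma sin_frac_ge0 (k y : R) : 0 < k -> 0 <= y <= k -> 0 <= sin (pi * y / k).
Proof.
move=> k0 /andP[y0 yk]; have pi0 := pi_ge0 R; apply: sin_ge0_pi.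
by rewrite divr_ge0 ?mulr_ge0 ?(ltW k0) //= ler_pdivrMr // ler_wpM2l.
Qed.

Lemma sin_frac_le0 (k y : R) : 0 < k -> - k <= y <= 0 -> sin (pi * y / k) <= 0.
Proof.
move=> k0 yk; rewrite -oppr_ge0 -sinN -mulNr -mulrN; apply: sin_frac_ge0 => //; lra.
Qed.

Lemma sin_frac_eq0 (k y : R) : 0 < k -> 0 <= y <= k -> sin (pi * y / k) = 0 -> y = 0 \/ y = k.
Proof.
move=> k0 /andP[y0 yk] s0; have pi0 := pi_gt0 R.
have [->|ny] := eqVneq y 0; first by left.
have [->|nk] := eqVneq y k; first by right.
have : 0 < sin (pi * y / k).
  have yp : 0 < y by rewrite lt0r ny.
  apply: sin_gt0_pi; rewrite divr_gt0 ?mulr_gt0 //= ltr_pdivrMr // ltr_pM2l //.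
  by rewrite lt_neqAle nk.
by rewrite s0 ltxx.
Qed.

Lemma sum_window (N : nat) (f : nat -> R) c : (forall i, f (i + N)%N = f i) ->
  \sum_(c <= i < c + N) f i = \sum_(0 <= i < N) f i.
Proof.
move=> fN; elim: c => [|c IH] //.
have [->|N0] := posnP N; first by rewrite addn0 big_geq // big_geq.
rewrite -IH addSn big_nat_recr /=; last by rewrite -[X in (X < _)%N]addn0 ltn_add2l.
by rewrite [in RHS]big_ltn ?fN 1?addrC // -[X in (X < _)%N]addn0 ltn_add2l.
Qed.
End Aux.

Section Fourier.
Variable R : realType.
Implicit Types (u z w : R[i]).
Variables (Z : seq R[i]) (sg : R[i] -> bool) (N : nat) (pt : nat -> R[i]) (A : nat -> R).
Hypothesis Zsep : hull_separated Z sg.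
Hypothesis ang : angular_enumeration Z N pt A.
Local Notation nch := (nchanges (fun i => sg (pt i))).
Local Notation m := (nch N).

Definition phase i : R := 2 * pi * (nch i)%:R / m%:R.

(** Let [c] and [d] be the indices at which [det u] becomes nonnegative and
    nonpositive. The polynomial with value
    [sin (pi * (l - a) / k) * sin (pi * (b - l) / k)] at [l = 2 * nch i] has the
    sign of [det u (pt i)] throughout the turn, where [a / 2] is the number of
    changes at the cut [c], counted halfway if the colour changes there, and
    [b / 2] is that at [d]. By assumption the scalar product with it
    vanishes, hence so does every summand. Then each point is on one of the two
    rays of the cuts, or in one of the two blocks of colour that a cut goes
    through: at most two blocks are left, against [2 < m]. *)
Lemma nonvanishing u : u != 0 -> (2 < m)%N ->
  \sum_(0 <= i < N) det u (pt i) = 0 ->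
  \sum_(0 <= i < N) det u (pt i) * cos (phase i) = 0 ->
  \sum_(0 <= i < N) det u (pt i) * sin (phase i) = 0 -> False.
Proof.
move=> u0 m3 S0 Sc Ss.
have [[N0 _ _] _ ptAN Amono ptE] := ang.
have pi0 := pi_gt0 R.
have nchN i : nch (i + N)%N = (nch i + m)%N by have := nch_period sg ang i 1; rewrite !mul1n.
have [r [th [r0 thb uE]]] := polar u0.
pose T := th + 2 * pi.
have [|c [c0 cT cN]] := angular_cut ang (th := T); first by rewrite /T; lra.
have [|d [d0 dT dN]] := angular_cut ang (th := T + pi); first by rewrite /T; lra.
have cd : (c <= d)%N.
  by rewrite leqNgt; apply/negP => dc; move: (leqnn d) dc; rewrite dT ltnNge cT => h /negP;
    apply; lra.
have dcN : (d <= c + N)%N.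
  by rewrite dT (ptAN c).2; have := leqnn c; rewrite cT => h; lra.
pose k : R := 2 * m%:R.
have k0 : 0 < k by rewrite mulr_gt0 // ltr0n; clear -m3; lia.
pose a : R := (nch c.-1 + nch c)%:R; pose b : R := (nch d.-1 + nch d)%:R.
pose l i : R := 2 * (nch i)%:R.
pose X i := pi * (l i - a) / k; pose Y i := pi * (b - l i) / k.
pose G i := det u (pt i) * (cos (phase i) * cos (pi * (a + b) / k)
   + sin (phase i) * sin (pi * (a + b) / k) - cos (pi * (b - a) / k)).
have mR : m%:R != 0 :> R by rewrite pnatr_eq0; clear -m3; lia.
(* product-to-sum formula: [G] is the polynomial above times [det u (pt i)] *)
have GE i : G i = 2 * (det u (pt i) * (sin (X i) * sin (Y i))).
  have e1 : phase i - pi * (a + b) / k = X i - Y i by rewrite /phase /X /Y /k /l; field.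
  have e2 : pi * (b - a) / k = X i + Y i by rewrite /X /Y /k /l; field.
  by rewrite /G -cosB e1 e2 cosB cosD; ring.
have GN i : G (i + N)%N = G i.
  rewrite /G (ptAN i).1.
  have -> : phase (i + N)%N = phase i + pi *+ 2.
    by rewrite /phase nchN natrD; field.
  by rewrite cosD2pi sinD2pi.
have SG : \sum_(c <= i < c + N) G i = 0.
  rewrite sum_window //.
  under eq_bigr => i _ do rewrite /G mulrBr mulrDr !mulrA.
  by rewrite sumrB big_split /= -!mulr_suml S0 Sc Ss !mul0r addr0 subr0.
have detE i : exists2 q, 0 < q & det u (pt i) = q * sin (A i - T).
  have [q q0 ->] := ptE i; exists (r * q); first by rewrite mulr_gt0.
  rewrite uE det_cis; have -> : A i - th = A i - T + pi *+ 2 by rewrite /T; ring.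
  by rewrite sinD2pi.
have mono i j : (i <= j)%N -> (nch i <= nch j)%N by exact: nchanges_mono.
have ab : a <= b /\ b <= a + k.
  rewrite /a /b /k -natrM -natrD !ler_nat; split.
    by apply: leq_add; apply: mono => //; rewrite -!subn1 leq_sub2r.
  have := mono d (c + N)%N dcN; have dc1 : (d.-1 <= c.-1 + N)%N by clear -dcN c0; lia.
  by have := mono _ _ dc1; rewrite !nchN; clear; lia.
have first i : (c <= i < d)%N -> [/\ a <= l i, l i <= b & T <= A i < T + pi].
  move=> /andP[ci id]; rewrite -cT ci ltNge -dT -ltnNge id; split=> //.
    rewrite /a /l -natrM ler_nat; have := mono c i ci.
    have cc : (c.-1 <= c)%N by exact: leq_pred.
    by have := mono _ _ cc; clear; lia.
  rewrite /b /l -natrM ler_nat; have id1 : (i <= d.-1)%N by clear -id; lia.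
  have := mono i d.-1 id1.
  have dd : (d.-1 <= d)%N by exact: leq_pred.
  by have := mono _ _ dd; clear; lia.
have second i : (d <= i < c + N)%N -> [/\ b <= l i, l i <= a + k & T + pi <= A i < T + 2 * pi].
  move=> /andP[di iN]; rewrite -dT di -cN iN; split=> //.
    rewrite /b /l -natrM ler_nat; have := mono d i di.
    have dd : (d.-1 <= d)%N by exact: leq_pred.
    by have := mono _ _ dd; clear; lia.
  rewrite /a /l /k -!natrM -natrD ler_nat; have ic : (i <= c.-1 + N)%N by clear -iN c0; lia.
  have := mono _ _ ic; have cc : (c.-1 <= c)%N by exact: leq_pred.
  by have := mono _ _ cc; rewrite nchN; clear; lia.
have G0 i : (c <= i < c + N)%N -> 0 <= G i.
  move=> /andP[ci iN]; rewrite GE mulr_ge0 //; have [q q0 ->] := detE i.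
  have [id|di] := ltnP i d.
    have [|h1 h2 h3] := first i; first by rewrite ci.
    rewrite !mulr_ge0 ?(ltW q0) ?sin_frac_ge0 ?sin_ge0_pi //; lra.
  have [|h1 h2 h3] := second i; first by rewrite di.
  apply: mulr_le0; first rewrite mulr_ge0_le0 ?(ltW q0) //.
    by rewrite -[A i - T](subrK pi) sinDpi oppr_le0 sin_ge0_pi //; lra.
  by rewrite mulr_ge0_le0 ?sin_frac_ge0 ?sin_frac_le0 //; lra.
have Gz i : (c <= i < c + N)%N -> G i = 0.
  move=> ci; move/eqP: SG; rewrite big_nat_cond psumr_eq0; last by move=> j; rewrite andbT;
    exact: G0.
  by move=> /allP/(_ i); rewrite mem_index_iota ci => /(_ isT)/eqP.
have same i j : (i <= j)%N -> A i = A j -> nch j = nch i.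
  move=> ij e; apply: nchanges_eq => // x /andP[ix xj]; apply: (same_ray Zsep ang).
  by apply/eqP; rewrite eq_le; apply/andP; split; [rewrite e|]; apply: Amono.
have natE (x y : nat) : x%:R = y%:R :> R -> x = y by move=> /eqP; rewrite eqr_nat => /eqP.
(* the number of changes is one of two residues modulo [m] *)
have two i : (c <= i < c + N)%N -> [\/ nch i = nch c, nch i = nch d | nch i = (nch c + m)%N].
  move=> /[dup] ciN /andP[ci iN]; have := Gz i ciN; rewrite GE.
  have [q q0 ->] := detE i => /eqP; rewrite !mulf_eq0 pnatr_eq0 /= (gt_eqF q0) /=.
  have cc : (c.-1 <= c)%N by exact: leq_pred.
  have dd : (d.-1 <= d)%N by exact: leq_pred.
  have Lc := mono _ _ cc; have Ld := mono _ _ dd.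
  have Lci := mono _ _ ci.
  have LiN := mono _ _ (ltnW iN); rewrite nchN in LiN.
  have [id|di] := ltnP i d.
    have [|h1 h2 /andP[h3 h4]] := first i; first by rewrite ci.
    have id1 : (i <= d.-1)%N by clear -id; lia.
    have Lid := mono _ _ id1.
    case/or3P => /eqP e.
    - constructor 1; apply: same => //; apply/eqP; rewrite eq_le Amono //=.
      have : T <= A c by rewrite -cT.
      suff -> : A i = T by [].
      apply/eqP; rewrite eq_le h3 andbT leNgt; apply/negP => lt.
      have : 0 < sin (A i - T) by apply: sin_gt0_pi; lra.
      by rewrite e ltxx.
    - have [||e1|e1] := sin_frac_eq0 _ _ e; rewrite ?k0 //; first by lra.
        constructor 1; have : l i = a by lra.
        by rewrite /l /a -natrM => /natE; move: Lc Lci; clear; lia.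
      constructor 2; have : l i = b by lra.
      by rewrite /l /b -natrM => /natE; move: Ld Lid; clear; lia.
    - have [||e1|e1] := sin_frac_eq0 _ _ e; rewrite ?k0 //; first by lra.
        constructor 2; have : l i = b by lra.
        by rewrite /l /b -natrM => /natE; move: Ld Lid; clear; lia.
      constructor 1; have : l i = a by lra.
      by rewrite /l /a -natrM => /natE; move: Lc Lci; clear; lia.
  have [|h1 h2 /andP[h3 h4]] := second i; first by rewrite di.
  have Ldi := mono _ _ di.
  have iN1 : (i <= c.-1 + N)%N by clear -iN c0; lia.
  have := mono _ _ iN1; rewrite nchN => Lic.
  have case_a : l i = a -> nch i = nch c.
    by rewrite /l /a -natrM => /natE; move: Lc Lci; clear; lia.
  have case_b : l i = b -> nch i = nch d.
    by rewrite /l /b -natrM => /natE; move: Ld Ldi; clear; lia.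
  have case_ak : l i = a + k -> nch i = (nch c + m)%N.
    by rewrite /l /a /k -!natrM -natrD => /natE; move: Lc Lic; clear; lia.
  case/or3P => /eqP e.
  - constructor 2; apply: same => //; apply/eqP; rewrite eq_le Amono //=.
    have : T + pi <= A d by rewrite -dT.
    suff -> : A i = T + pi by [].
    apply/eqP; rewrite eq_le h3 andbT leNgt; apply/negP => lt.
    have : 0 < sin (A i - T - pi) by apply: sin_gt0_pi; lra.
    have := sinDpi (A i - T - pi); rewrite subrK e => e2; lra.
  - have [||e1|e1] := sin_frac_eq0 _ _ e; rewrite ?k0 //; first by lra.
      by constructor 1; apply: case_a; lra.
    by constructor 3; apply: case_ak; lra.
  - have e' : sin (pi * (l i - b) / k) = 0.
      by rewrite -[l i - b]opprB mulrN mulNr sinN e oppr0.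
    have [||e1|e1] := sin_frac_eq0 _ _ e'; rewrite ?k0 //; first by lra.
      by constructor 2; apply: case_b; lra.
    by constructor 3; apply: case_ak; lra.
have cN1 : (c <= c.-1 + N)%N by move: N0; clear; lia.
have iw : (c.-1 + N < c + N)%N by clear -c0; lia.
have big : (nch c + m <= (nch (c.-1 + N)).+1)%N.
  have : (nch c <= nch (c.-1) + 1)%N.
    by rewrite -{1}(prednK c0) nchangesS leq_add2l leq_b1.
  by rewrite nchN; clear; lia.
have [|i1 /andP[ci1 i1N] [_ li1]] := next_change (s := fun i => sg (pt i)) cN1;
  first by clear -big m3; lia.
have [|i2 /andP[ci2 i2N] [_ li2]] := next_change (s := fun i => sg (pt i)) i1N;
  first by clear -big li1 m3; lia.
have [|e1|e1|e1] := two i1 _; first by move: ci1 i1N iw; clear; lia.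
all: have [|e2|e2|e2] := two i2 _; first by move: ci1 ci2 i2N iw; clear; lia.
all: by move: e1 e2 li1 li2 m3; clear; lia.
Qed.
End Fourier.

(** * Sums over the lines of a direction *)

Section Fibres.
Variables (T K : eqType).
Implicit Types (s t : seq T).

(** Equal X-rays allow one to match the points of both sets line by line. *)
Lemma fibre_matching (key : T -> K) s t : perm_eq (map key s) (map key t) ->
  exists t', perm_eq t' t /\ map key s = map key t'.
Proof.
elim: s t => [|x s IH] t.
  move=> /perm_size/=; rewrite size_map => /esym/size0nil->; by exists [::].
move=> h; have /mapP[y yt xy] : key x \in map key t.
  by rewrite -(perm_mem h) mem_head.
have p := perm_to_rem yt.
have := perm_map key p; rewrite perm_sym => p2.
have {h} := perm_trans h (etrans (perm_sym _ _) p2); rewrite /= -xy perm_cons => /IH[t' [pt' e]].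
exists (y :: t'); split; last by rewrite /= e xy.
by rewrite perm_sym; apply: (perm_trans p); rewrite perm_cons perm_sym.
Qed.

Lemma fibre_sum (V : nmodType) (key : T -> K) s t (f g : T -> V) :
  perm_eq (map key s) (map key t) ->
  {in s & t, forall x y, key x = key y -> f x = g y} ->
  \sum_(x <- s) f x = \sum_(y <- t) g y.
Proof.
move=> /fibre_matching[t' [pt e]] fg; rewrite -(perm_big _ pt) /=.
have {fg} : {in s & t', forall x y, key x = key y -> f x = g y}.
  by move=> x y xs yt; apply: fg => //; rewrite -(perm_mem pt).
elim: s t' e {pt} => [|x s IH] [|y t'] //=; first by rewrite !big_nil.
move=> [xy e] fg; rewrite !big_cons (fg x y) ?mem_head //; congr (_ + _).
by apply: IH => // a b as_ bt; apply: fg; rewrite inE ?as_ ?bt orbT.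
Qed.

Lemma fibre_sum_lt (V : realDomainType) (key : T -> K) s t (f g : T -> V) :
  perm_eq (map key s) (map key t) -> s != [::] ->
  {in s & t, forall x y, key x = key y -> f x < g y} ->
  \sum_(x <- s) f x < \sum_(y <- t) g y.
Proof.
move=> /fibre_matching[t' [pt e]] s0 fg; rewrite -(perm_big _ pt) /=.
have {fg} : {in s & t', forall x y, key x = key y -> f x < g y}.
  by move=> x y xs yt; apply: fg => //; rewrite -(perm_mem pt).
case: s t' s0 e {pt} => [|x s] [|y t'] //= _ [xy e] fg; rewrite !big_cons.
apply: ltr_leD; first by apply: fg; rewrite ?mem_head.
have {}fg : {in s & t', forall x y, key x = key y -> f x < g y}.
  by move=> a b as_ bt; apply: fg; rewrite inE ?as_ ?bt orbT.
elim: s t' e fg {xy} => [|a s IH] [|b t'] //=; first by rewrite !big_nil.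
move=> [ab e] fg; rewrite !big_cons lerD //; first by rewrite ltW // fg ?mem_head.
by apply: IH => // c d cs dt; apply: fg; rewrite inE ?cs ?dt orbT.
Qed.
End Fibres.

(** * Equal X-rays make the directions cyclotomic *)

Section Tomography.
Variable R : realType.
Implicit Types (u z w : R[i]) (Z : seq R[i]).
Local Notation conj := (@conjc R).

(** If all right points had the same colour, then this colour would have the
    larger sum of the coordinates along [u]. *)
Lemma both_sides Z (sg : pred R[i]) u (P := [seq z <- Z | sg z]) (Q := [seq z <- Z | ~~ sg z]) :
  hull_separated Z sg -> u != 0 -> P != [::] ->
  perm_eq (map (det u) P) (map (det u) Q) ->
  \sum_(z <- P) z = 0 -> \sum_(z <- Q) z = 0 ->
  exists z w, [/\ z \in Z, w \in Z, sg z != sg w, is_right Z sg u z & is_right Z sg u w].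
Proof.
move=> Zsep u0 P0 PQ SP SQ.
have inP z : z \in P -> sg z /\ z \in Z by rewrite mem_filter => /andP.
have inQ z : z \in Q -> ~~ sg z /\ z \in Z by rewrite mem_filter => /andP.
have order p q : p \in P -> q \in Q -> det u p = det u q ->
    [/\ is_right Z sg u p = (dot u q < dot u p), is_right Z sg u q = (dot u p < dot u q) &
        dot u p != dot u q].
  move=> /inP[sp pZ] /inQ[sq qZ] e.
  have ne : sg q != sg p by rewrite sp (negPf sq).
  have ne' : sg p != sg q by rewrite eq_sym.
  by rewrite (is_rightP Zsep u0 pZ qZ ne (esym e)) (is_rightP Zsep u0 qZ pZ ne' e)
    (dot_neq Zsep u0 qZ pZ ne' e).
have [/hasP[z zP rz]|/hasPn nP] := boolP (has (is_right Z sg u) P); last first.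
  have H : {in P & Q, forall p q, det u p = det u q -> dot u p < dot u q}.
    move=> p q pP qQ e; have [rp _ ne] := order p q pP qQ e.
    by have := nP p pP; rewrite rp -leNgt le_eqVlt (negPf ne).
  by have := fibre_sum_lt PQ P0 H; rewrite -!dot_sum SP SQ ltxx.
have [/hasP[w wQ rw]|/hasPn nQ] := boolP (has (is_right Z sg u) Q).
  have [sz zZ] := inP z zP; have [sw wZ] := inQ w wQ.
  by exists z, w; split; rewrite // sz (negPf sw).
have QP : perm_eq (map (det u) Q) (map (det u) P) by rewrite perm_sym.
have Q0 : Q != [::].
  by rewrite -size_eq0 -(size_map (det u)) -(perm_size PQ) size_map size_eq0.
have H : {in Q & P, forall q p, det u q = det u p -> dot u q < dot u p}.
  move=> q p qQ pP e; have [_ rq ne] := order p q pP qQ (esym e).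
  by have := nQ q qQ; rewrite rq -leNgt le_eqVlt eq_sym (negPf ne).
by have := fibre_sum_lt QP Q0 H; rewrite -!dot_sum SP SQ ltxx.
Qed.

(** [X u] is the first Fourier coefficient of the configuration, seen through the
    functional [det u]; it is written out as a combination of [A] and [B] to
    show that it is real linear in [u]. *)
Lemma fourier_directions Z (sg : pred R[i]) (U : seq R[i])
    (P := [seq z <- Z | sg z]) (Q := [seq z <- Z | ~~ sg z]) :
  hull_separated Z sg -> U != [::] -> (forall u, u \in U -> u != 0) ->
  P != [::] -> (forall u, u \in U -> perm_eq (map (det u) P) (map (det u) Q)) ->
  \sum_(z <- P) z = 0 -> \sum_(z <- Q) z = 0 ->
  exists m A B, let X u := (complex.Re u)%:C * B - (complex.Im u)%:C * A in
  [/\ (0 < m)%N, forall u, u != 0 -> X u != 0 &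
      forall u, u \in U -> exists2 t, t ^+ m = 1 & X u = t * conj (X u)].
Proof.
move=> Zsep Une U0 P0 PQ SP SQ.
have [u1 u1U] : exists u, u \in U by case: (U) Une => // u ? _; exists u; rewrite mem_head.
have inP z : z \in P -> sg z /\ z \in Z by rewrite mem_filter => /andP.
have inQ z : z \in Q -> ~~ sg z /\ z \in Z by rewrite mem_filter => /andP.
have mU u : u \in U -> mated Z sg u.
  move=> uU z zZ; have [sz|sz] := boolP (sg z).
    have : det u z \in map (det u) Q.
      by rewrite -(perm_mem (PQ u uU)); apply: map_f; rewrite mem_filter sz.
    by move=> /mapP[w /inQ[sw wZ] e]; exists w; split; rewrite // (negPf sw).
  have : det u z \in map (det u) P.
    by rewrite (perm_mem (PQ u uU)); apply: map_f; rewrite mem_filter /= sz.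
  by move=> /mapP[w /inP[sw wZ] e]; exists w; split; rewrite // sw.
have [z0 z0P] : exists z, z \in P by case: (P) P0 => // z ? _; exists z; rewrite mem_head.
have [_ z0Z] := inP _ z0P.
have Zn : (0 < size Z)%N by case: (Z) z0Z.
have Z0 : 0 \notin Z.
  apply/negP => oZ; have [w [wZ sw _]] := mU u1 u1U 0 oZ.
  apply: (Zsep 0 w w 0 0 oZ wZ wZ sw sw (lexx _) (lexx _)); first by rewrite addr0.
  by rewrite !mul0r addr0.
have [pt [A ang]] := angular_exists Zn Z0.
set N := size Z in Zn ang.
have permZ : perm_eq (map pt (index_iota 0 N)) Z by case: ang => _; rewrite /index_iota subn0.
pose I := [seq i <- index_iota 0 N | sg (pt i)].
pose J := [seq i <- index_iota 0 N | ~~ sg (pt i)].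
have permI : perm_eq (map pt I) P by rewrite -filter_map; exact: perm_filter.
have permJ : perm_eq (map pt J) Q by rewrite -(filter_map pt (predC sg)); exact: perm_filter.
have IJ u : u \in U -> perm_eq (map (det u \o pt) I) (map (det u \o pt) J).
  move=> uU; rewrite (map_comp (det u) pt I) (map_comp (det u) pt J);
    apply: perm_trans (perm_map _ permI) _.
  by apply: perm_trans (PQ u uU) _; rewrite perm_sym; apply: perm_map.
have splitIJ (V : nmodType) (f : nat -> V) :
    \sum_(0 <= i < N) f i = \sum_(i <- I) f i + \sum_(i <- J) f i.
  by rewrite (bigID (fun i => sg (pt i))) /= /I /J !big_filter.
have Sdet u : \sum_(0 <= i < N) det u (pt i) = 0.
  rewrite splitIJ -!(big_map pt xpredT (det u)) (perm_big _ permI) (perm_big _ permJ) /=.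
  by rewrite -!det_sum SP SQ /det /= !mulr0 subrr addr0.
pose nch := nchanges (fun i => sg (pt i)); pose m := nch N.
have m3 : (3 < m)%N.
  apply: (direction_nchanges Zsep ang (U0 _ u1U) (mU _ u1U)).2.
  exact: (both_sides Zsep (U0 _ u1U) P0 (PQ _ u1U) SP SQ).
have m0 : (0 < m)%N by apply: leq_trans m3.
pose om := zeta R m; have omm : om ^+ m = 1 by exact: zeta_unity.
pose W i := om ^+ nch i.
have WE i : W i = cis (phase sg N pt i).
  rewrite /W /om /zeta cisX /phase; congr cis.
  by rewrite -[LHS]mulr_natr mulrAC.
exists m, (\sum_(0 <= i < N) (complex.Re (pt i))%:C * W i),
  (\sum_(0 <= i < N) (complex.Im (pt i))%:C * W i); set X := fun u => _.
have XE u : X u = \sum_(0 <= i < N) (det u (pt i))%:C * W i.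
  rewrite /X !big_distrr -sumrB; apply: eq_bigr => i _.
  by rewrite /det rmorphB !rmorphM /= !mulrA -mulrBl.
split=> // [u u0|u uU].
  apply/eqP => X0.
  have ReIm (f : nat -> R) (g h : nat -> R) : \sum_(0 <= i < N) (f i)%:C * (g i +i* h i) =
     (\sum_(0 <= i < N) f i * g i) +i* (\sum_(0 <= i < N) f i * h i).
    elim: (index_iota 0 N) => [|i s IH]; first by rewrite !big_nil.
    by rewrite !big_cons IH; apply/eqP; rewrite eq_complex /= !mul0r subr0 addr0 !eqxx.
  move: X0; rewrite XE; under eq_bigr => i _ do rewrite WE /cis.
  rewrite ReIm => /eqP; rewrite eq_complex /= => /andP[/eqP c0 /eqP s0].
  exact: (nonvanishing Zsep ang u0 (ltnW m3) (Sdet u) c0 s0).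
have [k kE] := (direction_nchanges Zsep ang (U0 _ uU) (mU _ uU)).1.
exists (om ^+ k); first by rewrite exprAC omm expr1n.
have WW i j : sg (pt i) != sg (pt j) -> det u (pt i) = det u (pt j) ->
    W i = om ^+ k * conj (W j).
  move=> ne e; have -> : om ^+ k = W i * W j.
    by rewrite -exprD -(expr_mod _ omm) -(kE i j ne e) (expr_mod _ omm).
  by rewrite -mulrA WE (WE j) cis_conj mulr1.
pose f i := (det u (pt i))%:C * W i; pose g i := om ^+ k * conj (f i).
have fgE i j : sg (pt i) != sg (pt j) -> det u (pt i) = det u (pt j) -> f i = g j.
  move=> ne e; rewrite /g; have -> : conj (f j) = (det u (pt j))%:C * conj (W j).
    by rewrite /f [LHS]rmorphM; congr (_ * _); rewrite /= oppr0.
  by rewrite /f (WW i j ne e) e; exact: mulrCA.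
have conjS (s : seq nat) : \sum_(i <- s) g i = om ^+ k * conj (\sum_(i <- s) f i).
  by rewrite rmorph_sum -big_distrr.
have fIJ : \sum_(i <- I) f i = \sum_(j <- J) g j.
  apply: (fibre_sum (IJ u uU)) => i j; rewrite !mem_filter => /andP[si _] /andP[sj _] e.
  by apply: fgE => //; rewrite si (negPf sj).
have fJI : \sum_(j <- J) f j = \sum_(i <- I) g i.
  have := IJ u uU; rewrite perm_sym => JI.
  apply: (fibre_sum JI) => j i; rewrite !mem_filter => /andP[sj _] /andP[si _] e.
  by apply: fgE => //; rewrite si (negPf sj).
by rewrite XE splitIJ -/f rmorphD mulrDr -!conjS {1}fIJ {1}fJI addrC.
Qed.
End Tomography.

(** * Cross ratios *)

Section CrossRatio.
Variable R : realType.
Implicit Types (u v : R[i]).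

Lemma cross_ratio_det u1 u2 u3 u4 : det u1 u2 != 0 -> det u1 u3 != 0 -> det u1 u4 != 0 ->
  det u2 u3 != 0 -> det u2 u4 != 0 -> det u3 u4 != 0 ->
  cross_ratio (slope u1) (slope u2) (slope u3) (slope u4) =
    det u1 u3 * det u2 u4 / (det u2 u3 * det u1 u4).
Proof.
case: u1 u2 u3 u4 => [x1 y1] [x2 y2] [x3 y3] [x4 y4]; rewrite /det /slope /=.
move=> h12 h13 h14 h23 h24 h34.
case: (eqVneq x1 0) h12 h13 h14 => [->|z1] h12 h13 h14;
case: (eqVneq x2 0) h12 h23 h24 => [->|z2] h12 h23 h24;
case: (eqVneq x3 0) h13 h23 h34 => [->|z3] h13 h23 h34;
case: (eqVneq x4 0) h14 h24 h34 => [->|z4] h14 h24 h34;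
  rewrite ?(mul0r, mulr0, sub0r, subr0, oppr0, oppr_eq0, mulf_eq0, negb_or,
    eqxx) //= in h12 h13 h14 h23 h24 h34 *.
all: try by rewrite ?andbF in h12 h13 h14 h23 h24 h34.
all: field.
all: try move/andP: h12 => [? ?]; try move/andP: h13 => [? ?]; try move/andP: h14 => [? ?].
all: try move/andP: h23 => [? ?]; try move/andP: h24 => [? ?]; try move/andP: h34 => [? ?].
all: by repeat (apply/andP; split).
Qed.

Local Notation conj := (@conjc R).

(** An injective real linear map [X] preserves cross ratios of lines, and the line
    through [X u] has the inclination of a square root of [t]. *)
Lemma cross_ratio_unit (A B : R[i]) (X := fun u => (complex.Re u)%:C * B - (complex.Im u)%:C * A)
    (u1 u2 u3 u4 t1 t2 t3 t4 : R[i]) :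
  (forall u, u != 0 -> X u != 0) ->
  det u1 u2 != 0 -> det u1 u3 != 0 -> det u1 u4 != 0 ->
  det u2 u3 != 0 -> det u2 u4 != 0 -> det u3 u4 != 0 ->
  X u1 = t1 * conj (X u1) -> X u2 = t2 * conj (X u2) ->
  X u3 = t3 * conj (X u3) -> X u4 = t4 * conj (X u4) ->
  [/\ t1 != t3, t2 != t4, t2 != t3, t1 != t4 &
    (cross_ratio (slope u1) (slope u2) (slope u3) (slope u4))%:C =
      (t1 - t3) * (t2 - t4) / ((t2 - t3) * (t1 - t4))].
Proof.
move=> X0 h12 h13 h14 h23 h24 h34 e1 e2 e3 e4.
pose K := A * conj B - conj A * B.
have conjX u : conj (X u) = (complex.Re u)%:C * conj B - (complex.Im u)%:C * conj A.
  by rewrite /X rmorphB !rmorphM /= oppr0.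
have detK u v s t : X u = s * conj (X u) -> X v = t * conj (X v) ->
    (det u v)%:C * K = conj (X u) * conj (X v) * (s - t).
  move=> eu ev.
  have -> : conj (X u) * conj (X v) * (s - t) =
     (s * conj (X u)) * conj (X v) - conj (X u) * (t * conj (X v)) by ring.
  rewrite -eu -ev !conjX /X /K /det rmorphB !rmorphM /=; ring.
(* [K] is, up to the factor 2i, the determinant of the linear map [X] *)
have K0 : K != 0.
  apply/eqP => K0.
  have kill x y : x%:C * B - y%:C * A = 0 -> x = 0 /\ y = 0.
    move=> e; have [/eqP|n] := eqVneq (x +i* y) 0.
      by rewrite eq_complex /= => /andP[/eqP-> /eqP->].
    by have := X0 _ n; rewrite /X /= e eqxx.
  have a : complex.Im A * complex.Re B = complex.Re A * complex.Im B.
    move: K0; rewrite /K; case: (A) (B) => [a1 a2] [b1 b2].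
    by move=> /eqP; rewrite eq_complex /= => /andP[_ /eqP]; lra.
  have [] := kill (complex.Re A) (complex.Re B).
    move: a; case: (A) (B) => [a1 a2] [b1 b2] /= a.
    by apply/eqP; rewrite eq_complex /=; apply/andP; split; apply/eqP; lra.
  have [] := kill (complex.Im A) (complex.Im B).
    move: a; case: (A) (B) => [a1 a2] [b1 b2] /= a.
    by apply/eqP; rewrite eq_complex /=; apply/andP; split; apply/eqP; lra.
  move=> a2 b2 a1 b1; have [] := kill 1 0; last by move=> /eqP; rewrite oner_eq0.
  move: a1 a2 b1 b2; case: (A) (B) => [a1 a2] [b1 b2] /= -> -> -> ->.
  by apply/eqP; rewrite eq_complex /=; apply/andP; split; apply/eqP; ring.
have nzc u v : det u v != 0 -> conj (X u) != 0.
  move=> d; rewrite conjc_eq0; apply: X0; apply: contraNneq d => ->.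
  by rewrite /det /= !mul0r subrr.
have nz u v s t : det u v != 0 -> X u = s * conj (X u) -> X v = t * conj (X v) -> s != t.
  move=> d eu ev; apply: contraNneq d => e; have := detK u v s t eu ev.
  rewrite e subrr mulr0 => /eqP; rewrite mulf_eq0 (negPf K0) orbF.
  by rewrite eq_complex /= eqxx andbT.
have n13 := nz _ _ _ _ h13 e1 e3; have n24 := nz _ _ _ _ h24 e2 e4.
have n23 := nz _ _ _ _ h23 e2 e3; have n14 := nz _ _ _ _ h14 e1 e4.
split=> //; rewrite cross_ratio_det //.
have dE u v s t (eu : X u = s * conj (X u)) (ev : X v = t * conj (X v)) :
    (det u v)%:C = conj (X u) * conj (X v) * (s - t) / K.
  by rewrite -(detK u v s t eu ev) mulfK.
have := dE _ _ _ _ e1 e3; have := dE _ _ _ _ e2 e4; have := dE _ _ _ _ e2 e3;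
  have := dE _ _ _ _ e1 e4.
rewrite fmorph_div !rmorphM /= => -> -> -> ->.
move: n23 n14 (nzc _ _ h12) (nzc _ _ h23) (nzc _ _ h34).
have h41 : det u4 u1 != 0 by rewrite detC oppr_eq0.
move: (nzc _ _ h41); rewrite -(subr_eq0 t2) -(subr_eq0 t1).
set c1 := conj (X u1); set c2 := conj (X u2); set c3 := conj (X u3); set c4 := conj (X u4).
move=> z4 n23 n14 z1 z2 z3; field.
by rewrite K0 z1 z2 z3 z4 n23 n14.
Qed.
End CrossRatio.

(** * Convex hulls *)

Section Hull.
Variable R : realType.
Implicit Types (F : set R[i]) (x y : R[i]).

Lemma sub_conv_hull F : F `<=` conv_hull F.
Proof. exact: sub_gen_smallest. Qed.

Lemma conv_hull_segment F x y (t : R) : conv_hull F x -> conv_hull F y -> 0 <= t <= 1 ->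
  conv_hull F (t%:C * x + (1 - t)%:C * y).
Proof.
move=> xF yF t01 G [cG FG].
have := cG x y (Itv01 (andP t01).1 (andP t01).2) (mem_set (xF G _)) (mem_set (yF G _)).
move=> /(_ (conj cG FG) (conj cG FG)) /set_mem; congr G.
rewrite /conv /=.
case: x y {xF yF} => [x1 x2] [y1 y2]; rewrite /unstable.onem /=.
by apply/eqP; rewrite eq_complex /= !mul0r !subr0 !addr0 !eqxx.
Qed.

Lemma conv_hull_mean F (s : seq R[i]) : s != [::] -> (forall x, x \in s -> F x) ->
  conv_hull F ((size s)%:R^-1 * \sum_(x <- s) x).
Proof.
elim: s => // x s IH _ sF.
have xF : conv_hull F x by apply: sub_conv_hull; apply: sF; rewrite mem_head.
have [->|s0] := eqVneq s [::]; first by rewrite big_seq1 invr1 mul1r.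
have {}IH := IH s0 (fun y ys => sF y (mem_behead (s := x :: s) ys)).
have n0 : (0 : R) < (size s)%:R by rewrite ltr0n lt0n size_eq0.
set n := size s in n0 IH *.
have := conv_hull_segment xF IH (t := (n%:R + 1)^-1).
have -> : (n%:R + 1)^-1%:C = ((size (x :: s))%:R)^-1 :> R[i].
  by rewrite natr1 fmorphV rmorph_nat.
have -> : (1 - (n%:R + 1)^-1)%:C = (size (x :: s))%:R^-1 * n%:R :> R[i].
  have -> : 1 - (n%:R + 1)^-1 = n.+1%:R^-1 * n%:R :> R.
    by rewrite -natr1; field; rewrite natr1 pnatr_eq0.
  by rewrite rmorphM fmorphV !rmorph_nat.
rewrite big_cons mulrDr -mulrA (mulrA n%:R) mulfV ?mul1r; last first.
  by rewrite pnatr_eq0; move: n0; rewrite ltr0n lt0n.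
apply; rewrite invr_ge0 invf_le1; lra.
Qed.

Lemma conv_hull_wedge F o x y (s t : R) : conv_hull F o -> conv_hull F x -> conv_hull F y ->
  0 <= s -> 0 <= t -> s + t <= 1 -> conv_hull F (s%:C * (x - o) + t%:C * (y - o) + o).
Proof.
move=> Fo Fx Fy s0 t0 st.
have [e|ne] := eqVneq (s + t) 0.
  have [-> ->] : s = 0 /\ t = 0 by split; lra.
  by rewrite !mul0r !add0r.
have st0 : 0 < s + t by rewrite lt0r ne addr_ge0.
have h1 : conv_hull F ((s / (s + t))%:C * x + (1 - s / (s + t))%:C * y).
  by apply: conv_hull_segment => //; rewrite divr_ge0 ?(ltW st0) //= ler_pdivrMr //; lra.
have := conv_hull_segment h1 Fo (t := s + t); rewrite addr_ge0 // st => /(_ isT).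
congr (conv_hull F _); rewrite mulrDr !mulrA -!rmorphM /=.
have -> : (s + t) * (s / (s + t)) = s by field.
have -> : (s + t) * (1 - s / (s + t)) = t by field.
by rewrite rmorphB rmorphD rmorph1 /=; ring.
Qed.
End Hull.

(** * From X-rays to coloured configurations *)

Section Xray.
Variable R : realType.
Implicit Types (u v z : R[i]) (F S l : set R[i]).

Lemma direction_sqr u : direction u -> complex.Re u ^+ 2 + complex.Im u ^+ 2 = 1.
Proof.
case: u => a b; rewrite /direction normc_def => -[] h /=.
by rewrite -[LHS]sqr_sqrtr ?addr_ge0 ?sqr_ge0 // h expr1n.
Qed.

Lemma direction_neq0 u : direction u -> u != 0.
Proof. by rewrite /direction => h; rewrite -normr_eq0 h oner_eq0. Qed.

Lemma det_neq0 u v : direction u -> direction v -> ~ parallel u v -> det u v != 0.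
Proof.
move=> /direction_sqr u1 /direction_sqr v1 np; apply/eqP => d; apply: np.
case: u v u1 v1 d => [a b] [c e]; rewrite /det /= => u1 v1 d.
have d1 : b * (a * e - b * c) = 0 by rewrite d mulr0.
have d2 : a * (a * e - b * c) = 0 by rewrite d mulr0.
have c' : c = (a * c + b * e) * a by rewrite -[LHS]mul1r -u1; lra.
have e' : e = (a * c + b * e) * b by rewrite -[LHS]mul1r -u1; lra.
exists (a * c + b * e).
  apply/eqP => z; have c0 : c = 0 by rewrite c' z mul0r.
  have e0 : e = 0 by rewrite e' z mul0r.
  by move: v1; rewrite c0 e0; lra.
by apply/eqP; rewrite eq_complex /= !mul0r subr0 addr0 -c' -e' !eqxx.
Qed.

Lemma level_line u z : direction u ->
  lines_parallel_to u [set w | det u w = det u z].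
Proof.
move=> /direction_sqr u1; exists z; apply/seteqP; split => w /=.
  case: u z w u1 => [a b] [c e] [x y]; rewrite /det /= => u1 d.
  exists (a * (x - c) + b * (y - e)) => //.
  apply/eqP; rewrite eq_complex /= !mul0r subr0 addr0; apply/andP; split; apply/eqP.
    have hx : c + (a ^+ 2 + b ^+ 2) * (x - c) = x by rewrite u1; ring.
    rewrite -[RHS]hx.
    have d1 : b * (a * y - b * x) = b * (a * e - b * c) by rewrite d.
    lra.
  have hy : e + (a ^+ 2 + b ^+ 2) * (y - e) = y by rewrite u1; ring.
  rewrite -[RHS]hy.
  have d1 : a * (a * y - b * x) = a * (a * e - b * c) by rewrite d.
  lra.
move=> [s _ <-]; case: u z u1 => [a b] [c e]; rewrite /det /= => u1; ring.
Qed.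

Lemma xray_count F u (t : R) : finite_set F ->
  xray F [set w | det u w = t] = count (fun z => det u z == t) (fset_set F).
Proof.
move=> fF; rewrite /xray -size_filter; apply: perm_size.
have fFl : finite_set (F `&` [set w | det u w = t]) by apply: finite_setIl.
apply: uniq_perm; rewrite ?filter_uniq ?fset_uniq // => z.
rewrite mem_filter; apply/idP/idP.
  rewrite in_fset_set // inE => -[Fz <-]; rewrite eqxx /=.
  by rewrite in_fset_set // mem_set.
by move=> /andP[/eqP d]; rewrite in_fset_set // in_fset_set // !inE.
Qed.

Lemma eq_xray_perm F F' u (P := [seq z <- fset_set F | z \notin fset_set F'])
    (Q := [seq z <- fset_set F' | z \notin fset_set F]) :
  finite_set F -> finite_set F' -> direction u -> eq_xray u F F' ->
  perm_eq (map (det u) P) (map (det u) Q).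
Proof.
move=> fF fF' du xr.
set f : seq R[i] := fset_set F in P *; set f' : seq R[i] := fset_set F' in Q *.
have cnt z : count (fun w => det u w == det u z) f = count (fun w => det u w == det u z) f'.
  by rewrite -!xray_count //; apply/xr/level_line.
have common : perm_eq [seq z <- f | z \in f'] [seq z <- f' | z \in f].
  apply: uniq_perm; rewrite ?filter_uniq ?fset_uniq // => z.
  by rewrite !mem_filter andbC.
have cntPQ z : count (fun w => det u w == det u z) P = count (fun w => det u w == det u z) Q.
  have := cnt z.
  rewrite -(seq.permP (permEl (perm_filterC (mem f') f))) -(seq.permP (permEl (perm_filterC
    (mem f) f'))).
  by rewrite !count_cat (seq.permP common) => /addnI.
apply/allP => t; rewrite mem_cat => tPQ; rewrite /= !count_map.
have [z ->] : exists z, t = det u z by case/orP: tPQ => /mapP[z _ ->]; exists z.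
by apply/eqP; exact: cntPQ.
Qed.

(** The common points of [F] and [F'] contribute equally to both X-rays, so the
    two differences have equal X-rays as well. Their common centroid is a
    convex combination of points of [F] and of points of [F'], which makes it
    the right origin: it belongs to both hulls, and both differences have sum
    zero with respect to it. *)
Lemma xrays_fourier L F F' (U : seq R[i]) u1 u2 :
  convex_subsets L F -> convex_subsets L F' -> F <> F' ->
  (forall u, u \in U -> direction u) -> u1 \in U -> u2 \in U -> det u1 u2 != 0 ->
  (forall u, u \in U -> eq_xray u F F') ->
  exists m A B, let X u := (complex.Re u)%:C * B - (complex.Im u)%:C * A in
  [/\ (0 < m)%N, forall u, u != 0 -> X u != 0 &
      forall u, u \in U -> exists2 t, t ^+ m = 1 & X u = t * @conjc R (X u)].
Proof.
move=> [fF FL cF] [fF' F'L cF'] neF dU u1U u2U d12 xU.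
pose P := [seq z <- fset_set F | z \notin fset_set F'].
pose Q := [seq z <- fset_set F' | z \notin fset_set F].
have PQ u : u \in U -> perm_eq (map (det u) P) (map (det u) Q).
  by move=> uU; apply: eq_xray_perm => //; [exact: dU|exact: xU].
have inP z : z \in P -> F z /\ ~ F' z.
  rewrite mem_filter !in_fset_set // => /andP[/negP nF' /set_mem Fz].
  by split=> // /mem_set.
have inQ z : z \in Q -> F' z /\ ~ F z.
  rewrite mem_filter !in_fset_set // => /andP[/negP nF /set_mem F'z].
  by split=> // /mem_set.
have sPQ : size P = size Q by have := perm_size (PQ _ u1U); rewrite !size_map.
have P0 : P != [::].
  apply/negP => /eqP Pn; have Qn : Q = [::] by apply: size0nil; rewrite -sPQ Pn.
  apply: neF; apply/seteqP; split=> z.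
    move=> Fz; apply: contrapT => nF'; suff : z \in P by rewrite Pn.
    by rewrite mem_filter !in_fset_set // (mem_set Fz) andbT; apply/negP => /set_mem.
  move=> F'z; apply: contrapT => nF; suff : z \in Q by rewrite Qn.
  by rewrite mem_filter !in_fset_set // (mem_set F'z) andbT; apply/negP => /set_mem.
have Q0 : Q != [::] by rewrite -size_eq0 -sPQ size_eq0.
have SPQ : \sum_(z <- P) z = \sum_(z <- Q) z.
  have e u : u \in U -> det u (\sum_(z <- P) z - \sum_(z <- Q) z) = 0.
    move=> uU; rewrite detB !det_sum (fibre_sum (f := det u) (g := det u) (PQ u uU)) ?subrr //.
  apply/eqP; rewrite -subr_eq0; apply/eqP.
  move: (e _ u1U) (e _ u2U) d12; case: (_ - _) u1 u2 {u1U u2U} => [x y] [a b] [c d].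
  rewrite /det /= => e1 e2 nz; congr (_ +i* _).
    apply: (mulfI nz); have := congr1 ( *%R c) e1; have := congr1 ( *%R a) e2; lra.
  by apply: (mulfI nz); have := congr1 ( *%R d) e1; have := congr1 ( *%R b) e2; lra.
pose o := (size P)%:R^-1 * \sum_(z <- P) z.
have oF : conv_hull F o by apply: conv_hull_mean => // z /inP[].
have oF' : conv_hull F' o by rewrite /o SPQ sPQ; apply: conv_hull_mean => // z /inQ[].
pose Z := [seq z - o | z <- P ++ Q].
pose sg z := z + o \in P.
have disj z : z \in Q -> z \in P = false.
  by move=> /inQ[F'z _]; apply/negP => /inP[_].
have PE : [seq z <- Z | sg z] = [seq z - o | z <- P].
  rewrite /Z filter_map filter_cat; congr map.
  rewrite -[RHS]cats0; congr (_ ++ _).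
    by apply/all_filterP/allP => z zP /=; rewrite /sg subrK.
  by rewrite -(filter_pred0 Q); apply: eq_in_filter => z zQ /=; rewrite /sg subrK disj.
have QE : [seq z <- Z | ~~ sg z] = [seq z - o | z <- Q].
  rewrite /Z filter_map filter_cat; congr map.
  rewrite -[RHS]cat0s; congr (_ ++ _).
    by rewrite -(filter_pred0 P); apply: eq_in_filter => z zP /=; rewrite /sg subrK zP.
  by apply/all_filterP/allP => z zQ /=; rewrite /sg subrK disj.
have nP0 : (size P)%:R != 0 :> R[i] by rewrite pnatr_eq0 size_eq0.
have center (s : seq R[i]) : size s = size P -> \sum_(z <- s) z = \sum_(z <- P) z ->
    \sum_(z <- [seq z - o | z <- s]) z = 0.
  move=> ss Ss; rewrite big_map sumrB Ss big_const_seq count_predT ss.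
  by rewrite iter_addr addr0 -mulr_natl /o mulrA mulfV // mul1r subrr.
have inZ z : z \in Z -> if sg z then F (z + o) /\ ~ F' (z + o) else F' (z + o) /\ ~ F (z + o).
  rewrite /sg; case: ifP => [/inP //|nP] /mapP[w wPQ e]; move: nP.
  by rewrite e subrK => nP; apply: inQ; move: wPQ; rewrite mem_cat nP.
apply: (@fourier_directions _ Z sg U).
- move=> z a b s t zZ aZ bZ sa sb s0 t0 st e.
  have zo : z + o = s%:C * ((a + o) - o) + t%:C * ((b + o) - o) + o by rewrite !addrK e.
  have := inZ z zZ; have := inZ a aZ; have := inZ b bZ.
  move: sa sb; case: (sg z) (sg a) (sg b) => [] [] [] //= _ _ [Fb _] [Fa _] [Fz nF'z];
    apply: nF'z.
    rewrite cF'; split; last exact: FL.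
    by rewrite zo; apply: conv_hull_wedge => //; exact: sub_conv_hull.
  rewrite cF; split; last exact: F'L.
  by rewrite zo; apply: conv_hull_wedge => //; exact: sub_conv_hull.
- by apply: contraTneq u1U => ->.
- by move=> u /dU/direction_neq0.
- by rewrite PE -size_eq0 size_map size_eq0.
- move=> u uU; rewrite PE QE -!map_comp.
  have mapE s : map (det u \o (fun z => z - o)) s = map (fun t => t - det u o) (map (det u) s).
    by rewrite -map_comp; apply: eq_map => z /=; rewrite detB.
  by rewrite !mapE; apply/perm_map/PQ.
- by rewrite PE; apply: center.
- by rewrite QE; apply: center.
Qed.
End Xray.

(** * Norms of cross ratios of roots of unity *)

Lemma Cyclotomic1E : 'Phi_1 = 'X - 1 :> {poly int}.
Proof. by have := prod_Cyclotomic (isT : 0 < 1)%N; rewrite /= big_seq1 expr1. Qed.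

(** Evaluate [('X^d - 1) / ('X - 1)] at 1: the value is [d], and the cyclotomic
    polynomial is a factor. *)
Lemma Cyclotomic_at1_dvd d : (1 < d)%N -> (('Phi_d).[1] %| d%:Z)%Z.
Proof.
move=> d1; have d0 := ltnW d1.
have := prod_Cyclotomic d0; rewrite (bigD1_seq 1%N) ?divisors_uniq ?div1 //=; last first.
  by rewrite -dvdn_divisors.
rewrite Cyclotomic1E subrX1 => /(mulfI _) E.
have {}E : \prod_(i <- divisors d | i != 1) 'Phi_i = \sum_(i < d) ('X : {poly int}) ^+ i.
  by apply: E; rewrite -size_poly_eq0 size_XsubC.
have dd : d \in divisors d by rewrite -dvdn_divisors.
rewrite (big_rem d dd) /= neq_ltn d1 orbT /= in E.
have := congr1 (horner^~ 1) E; rewrite hornerM horner_sum.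
under [\sum_(i < d) _]eq_bigr => i _ do rewrite hornerXn expr1n.
rewrite sumr_const card_ord => E1.
by have <- : _ = d%:Z := etrans E1 (natz d); exact: dvdz_mulr.
Qed.

Lemma leq_logn_totient p d : prime p -> (0 < d)%N -> (p.-1 * logn p d <= totient d)%N.
Proof.
move=> pp d0; case: (posnP (logn p d)) => [->|l0]; first by rewrite muln0.
have le1 : (totient (d`_p) <= totient d)%N.
  rewrite -[in leqRHS](partnC p d0) totient_coprime ?coprime_partC //.
  by rewrite leq_pmulr // totient_gt0 part_gt0.
apply: leq_trans le1; rewrite p_part totient_pfactor // leq_mul2l; apply/orP; right.
case: (logn p d) l0 => // k _ /=; elim: k => // k IH.
rewrite expnS; apply: leq_trans (_ : 2 * p ^ k <= _)%N; last by rewrite leq_mul2r prime_gt1 ?orbT.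
by rewrite mul2n -addnn -addn1 leq_add // expn_gt0 prime_gt0.
Qed.

Section Units.
Variable F : fieldType.

Definition algint (x : F) := integralOver (intr : int -> F) x.

(** The convention [0^-1 = 0] makes 0 a unit in this sense, so the value 0 has to
    be excluded where it matters. *)
Definition algunit (x : F) := algint x /\ algint x^-1.

Lemma algint_root n (z : F) : (0 < n)%N -> z ^+ n = 1 -> algint z.
Proof.
move=> n0 zn; exists ('X^n - 1); first exact: monicXnsubC.
by rewrite rmorphB rmorph1 /= map_polyXn rootE !hornerE zn subrr.
Qed.

Lemma algintM x y : algint x -> algint y -> algint (x * y).
Proof. exact: integral_mul. Qed.

Lemma algintX x n : algint x -> algint (x ^+ n).
Proof.
move=> ax; elim: n => [|n IH]; first exact: integral1.
by rewrite exprS; apply: algintM.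
Qed.

Lemma algint_sum (I : Type) (r : seq I) (P : pred I) (E : I -> F) :
  (forall i, P i -> algint (E i)) -> algint (\sum_(i <- r | P i) E i).
Proof. by move=> aE; apply: big_ind => //; [exact: mxpoly.integral0|exact: integral_add]. Qed.

Lemma algunitM x y : algunit x -> algunit y -> algunit (x * y).
Proof. by move=> [x1 x2] [y1 y2]; split; rewrite ?invfM; apply: algintM. Qed.

Lemma algunit1 : algunit 1.
Proof. by split; rewrite ?invr1; apply: integral1. Qed.

Lemma algunitV x : algunit x -> algunit x^-1.
Proof. by move=> [x1 x2]; split; rewrite ?invrK. Qed.

Lemma algunitX x n : algunit x -> algunit (x ^+ n).
Proof. by move=> [x1 x2]; split; rewrite -?exprVn; apply: algintX. Qed.

Lemma root_Cyclotomic n (z : F) : n.-primitive_root z -> root (map_poly intr 'Phi_n) z.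
Proof.
move=> pz; have n0 := prim_order_gt0 pz.
have evalE m : (0 < m)%N ->
    \prod_(d <- divisors m) (map_poly (intr : int -> F) 'Phi_d).[z] = z ^+ m - 1.
  move=> m0; have := congr1 (fun p => (map_poly (intr : int -> F) p).[z]) (prod_Cyclotomic m0).
  by rewrite /= rmorphB rmorph1 /= map_polyXn !hornerE rmorph_prod horner_prod.
have /eqP := evalE n n0; rewrite (prim_expr_order pz) subrr prodf_seq_eq0.
move=> /hasP[d]; rewrite -dvdn_divisors //= => dn dz.
have d0 := dvdn_gt0 n0 dn.
suff -> : n = d by [].
apply/eqP; rewrite eqn_dvd dn andbT (prim_order_dvd pz) -subr_eq0 -(evalE d d0).
by rewrite (big_rem d) /= ?(eqP dz) ?mul0r // -dvdn_divisors.
Qed.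

(** Both sides are monic of degree [totient n] and vanish at the primitive roots,
    which are distinct. *)
Lemma prim_cyclotomicE n (z : F) : n.-primitive_root z ->
  map_poly intr 'Phi_n = \prod_(k < n | coprime k n) ('X - (z ^+ k)%:P).
Proof.
move=> pz; have n0 := prim_order_gt0 pz.
have I1 : uniq_roots [seq z ^+ (k : 'I_n) | k : 'I_n <- index_enum 'I_n & coprime k n].
  rewrite uniq_rootsE map_inj_in_uniq ?filter_uniq ?index_enum_uniq //.
  by move=> i j _ _ /eqP; rewrite (eq_prim_root_expr pz) !modn_small // => /eqP/val_inj.
have := all_roots_prod_XsubC _ _ I1 => /(_ (map_poly intr 'Phi_n)).
rewrite (monicP _) ?monic_map ?Cyclotomic_monic // scale1r => -> //.
- by rewrite big_map big_filter.
- rewrite size_map_poly_id0; last by rewrite (monicP _) ?Cyclotomic_monic // rmorph1 oner_neq0.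
  rewrite size_Cyclotomic size_map size_filter; congr _.+1.
  rewrite totient_count_coprime -big_mkcond /= big_mkord.
  rewrite -sum1_count; apply: eq_bigl => i; exact: coprime_sym.
- apply/allP => x /mapP[k]; rewrite mem_filter => /andP[ck _] ->.
  by apply: root_Cyclotomic; rewrite prim_root_exp_coprime.
Qed.

Lemma prim_root_neq1 n (z : F) : n.-primitive_root z -> (1 < n)%N -> z != 1.
Proof.
move=> pz n1; apply/eqP => z1; have := prim_order_dvd pz 1.
by rewrite z1 expr1n eqxx dvdn1 => /eqP n2; rewrite n2 in n1.
Qed.

Lemma algint_quotient n (z : F) k : n.-primitive_root z -> (1 < n)%N ->
  algint ((1 - z ^+ k) / (1 - z)).
Proof.
move=> pz n1; have n0 := prim_order_gt0 pz; have z1 := prim_root_neq1 pz n1.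
rewrite -opprB -[1 - z]opprB invrN mulrNN subrX1 mulrAC divff ?mul1r ?subr_eq0 //.
by apply: algint_sum => i _; apply/algintX/(algint_root n0)/prim_expr_order.
Qed.

(** The inverse is a quotient of the same kind, because [z] is a power of the
    primitive root [z ^+ k]. *)
Lemma algunit_quotient n (z : F) k : n.-primitive_root z -> (1 < n)%N -> coprime k n ->
  algunit ((1 - z ^+ k) / (1 - z)).
Proof.
move=> pz n1 ckn; split; first exact: algint_quotient n1.
have n0 := prim_order_gt0 pz.
have [l zl] : exists l, z = (z ^+ k) ^+ l.
  have k0 : (0 < k)%N by case: k ckn => //; rewrite /coprime gcd0n => /eqP n2; rewrite n2 in n1.
  case: (egcdnP n k0) => l r E _; exists l.
  rewrite -exprM mulnC E (eqP ckn) exprD mulnC exprM (prim_expr_order pz) expr1n mul1r.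
  by rewrite expr1.
rewrite invfM invrK mulrC {1}zl; apply: algint_quotient n1.
by rewrite prim_root_exp_coprime.
Qed.

(** Valuations of algebraic numbers are expressed without prime ideals: some power
    [x ^+ d] is an integer [N] up to a unit, so [logn p N / d] is the p-adic
    valuation of [x], and it is at most [k / (p - 1)]. *)
Definition valuation_bounded (k : nat) (x : F) := exists d N e,
  [/\ (0 < d)%N, (0 < N)%N, x ^+ d = N%:R * e, algunit e &
      forall p, prime p -> (p.-1 * logn p N <= k * d)%N].

(** All factors of [Phi_d(1)], the product of the [1 - z ^+ k], agree up to
    units. *)
Lemma valuation_one_sub_root n (z : F) : (0 < n)%N -> z ^+ n = 1 -> z != 1 ->
  valuation_bounded 1 (1 - z).
Proof.
move=> n0 zn z1; have [d pz _] := prim_order_exists n0 zn.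
have d0 := prim_order_gt0 pz.
have d1 : (1 < d)%N.
  rewrite ltn_neqAle d0 andbT; apply: contraNneq z1 => E.
  by move: pz; rewrite -E => /prim_expr_order; rewrite expr1 => ->.
have E : (('Phi_d).[1])%:~R = \prod_(k < d | coprime k d) (1 - z ^+ k) :> F.
  have := congr1 (horner^~ 1) (prim_cyclotomicE pz).
  rewrite horner_prod -[X in (map_poly _ _).[X]](rmorph1 (intr : int -> F)) horner_map /= => ->.
  by apply: eq_bigr => i _; rewrite hornerXsubC.
pose q := \prod_(k < d | coprime k d) ((1 - z ^+ k) / (1 - z)).
have uq : algunit q.
  by apply: big_ind => [||i]; [exact: algunit1|exact: algunitM|exact: algunit_quotient].
have z1' : 1 - z != 0 by rewrite subr_eq0 eq_sym.
have q0 : q != 0.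
  apply/prodf_neq0 => k ck; rewrite mulf_neq0 ?invr_eq0 // subr_eq0 eq_sym.
  by apply: prim_root_neq1 d1; rewrite prim_root_exp_coprime.
have card : #|[pred k : 'I_d | coprime k d]| = totient d.
  rewrite totient_count_coprime -big_mkcond /= big_mkord -sum1_card.
  by apply: eq_bigl => i; exact: coprime_sym.
have E2 : (('Phi_d).[1])%:~R = (1 - z) ^+ totient d * q.
  rewrite E -card -prodr_const -big_split /=; apply: eq_bigr => i _.
  by rewrite mulrC divfK.
have dv := Cyclotomic_at1_dvd d1.
have [e [ue Ee]] : exists e : F, algunit e /\ (('Phi_d).[1])%:~R = (`|('Phi_d).[1]|%N)%:R * e.
  case: ('Phi_d).[1] => k.
    by exists 1; split; [exact: algunit1|rewrite mulr1].
  exists (-1); split; first by split; rewrite ?invrN ?invr1; apply/integral_opp/integral1.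
  by rewrite mulrN1 NegzE mulrNz.
exists (totient d), `|('Phi_d).[1]|%N, (e * q^-1); split.
- by rewrite totient_gt0.
- by rewrite absz_gt0; apply: contraTneq dv => ->; rewrite dvd0z -lt0n.
- by rewrite mulrA -Ee E2 mulfK.
- by apply: algunitM => //; apply: algunitV.
- move=> p pp; rewrite mul1n; apply: leq_trans (leq_logn_totient pp d0).
  by rewrite leq_mul2l; apply/orP; right; apply: dvdn_leq_log.
Qed.

Lemma valuation_boundedM k l x y : valuation_bounded k x -> valuation_bounded l y ->
  valuation_bounded (k + l) (x * y).
Proof.
move=> [d [N [e [d0 N0 xd ue hN]]]] [d' [N' [e' [d0' N0' yd ue' hN']]]].
exists (d * d')%N, (N ^ d' * N' ^ d)%N, (e ^+ d' * e' ^+ d); split.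
- by rewrite muln_gt0 d0.
- by rewrite muln_gt0 !expn_gt0 N0 N0'.
- rewrite exprMn exprM [in y ^+ _]mulnC [y ^+ _]exprM xd yd !exprMn -!natrX natrM.
  by rewrite mulrACA.
- by apply: algunitM; exact: algunitX.
- move=> p pp; rewrite lognM ?expn_gt0 ?N0 ?N0' // !lognX mulnDr mulnDl.
  apply: leq_add.
    by rewrite mulnCA [leqRHS]mulnA [leqRHS]mulnC leq_mul2l hN ?orbT.
  by rewrite mulnCA [leqRHS]mulnCA leq_mul2l hN' ?orbT.
Qed.
End Units.

(** By Gauss's lemma, ['X - q] divides a monic integer polynomial only if a
    rational multiple of it with leading coefficient 1 or -1 is integral. *)
Lemma algint_rat (q : rat) : algint q -> q \is a Num.int.
Proof.
move=> [p mp]; rewrite -dvdp_XsubCl => /dvdpP_rat_int[p1 [a a0 E] [r pE]].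
have : lead_coef p1 * lead_coef r = 1 by rewrite -lead_coefM -pE; apply/eqP.
move=> /eqP; rewrite mulrC; move/eqP => l1.
have aE : a * (lead_coef p1)%:~R = 1.
  have := congr1 lead_coef E; rewrite lead_coefXsubC lead_coefZ.
  by rewrite (lead_coef_map_inj (intr_inj : injective (intr : int -> rat))) // => <-.
have ai : a \is a Num.int.
  have -> : a = (lead_coef r)%:~R.
    have l1r : (lead_coef r)%:~R * (lead_coef p1)%:~R = 1 :> rat by rewrite -intrM l1.
    by rewrite -[LHS]mulr1 -[X in a * X]l1r mulrCA aE mulr1.
  by rewrite rpred_int.
have := congr1 (fun p : {poly rat} => p`_0) E.
rewrite coefB coefX coefC /= sub0r coefZ coef_map /= => qE.
by rewrite -[q]opprK qE rpredN rpredM // rpred_int.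
Qed.

Lemma algint_fmorph (F G : fieldType) (f : {rmorphism F -> G}) x : algint (f x) <-> algint x.
Proof.
split=> -[p mp rp]; exists p => //.
- by rewrite -(fmorph_root f) -map_poly_comp (eq_map_poly (rmorph_int f)).
- by move: rp; rewrite -(fmorph_root f) -map_poly_comp (eq_map_poly (rmorph_int f)).
Qed.

Lemma algunit_fmorph (F G : fieldType) (f : {rmorphism F -> G}) x : algunit (f x) <-> algunit x.
Proof.
split=> -[h1 h2]; split.
- exact: (algint_fmorph f _).1.
- by apply: (algint_fmorph f _).1; rewrite fmorphV.
- exact: (algint_fmorph f _).2.
- by rewrite -fmorphV; apply: (algint_fmorph f _).2.
Qed.

Lemma algunit_rat (q : rat) : q != 0 -> algunit q -> `|q| = 1.
Proof.
move=> q0 [/algint_rat qi /algint_rat vi]; apply/le_anti; rewrite norm_intr_ge1 // andbT.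
by rewrite -[leLHS]invrK -[leRHS]invr1 lef_pV2 ?posrE ?invr_gt0 ?normr_gt0 // -normfV
  norm_intr_ge1 ?invr_eq0.
Qed.

Section Norm.
Variables (L : splittingFieldType rat) (E : {subfield L}).

Lemma algint_galNorm a : algint a -> algint (galNorm 1 E a).
Proof.
move=> ia; apply: big_ind; [exact: integral1|exact: integral_mul|move=> x _].
exact/(algint_fmorph (x : 'AEnd(L))).
Qed.

Lemma galNorm_rat (r : rat) : galNorm 1 E r%:A = (r ^+ #|'Gal(E / 1)%g|)%:A.
Proof.
rewrite /galNorm (eq_bigr (fun=> r%:A)) ?prodr_const; first by rewrite exprZn expr1n.
by move=> x _; rewrite linearZ rmorph1.
Qed.

Lemma card_Gal_le : (#|'Gal(E / 1)%g| <= \dim {:L})%N.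
Proof.
rewrite dim_fixedField; apply: leq_trans (leq_div _ _) _.
by apply: dimvS; rewrite subvf.
Qed.
End Norm.

(** A prime factor p of [x] is at most [B + 1], and its exponent is at most
    [B]. *)
Lemma bounded_by_logn B x : (0 < x)%N ->
  (forall p, prime p -> (p.-1 * logn p x <= B)%N) -> (x <= B.+1`! ^ B)%N.
Proof.
move=> x0 H; apply: dvdn_leq; first by rewrite expn_gt0 fact_gt0.
apply/dvdn_partP => // p; rewrite mem_primes => /and3P[pp _ px].
have l0 : (0 < logn p x)%N by rewrite logn_gt0 mem_primes pp x0.
have p2 := prime_gt1 pp.
have pB : (p <= B.+1)%N.
  rewrite -(prednK (prime_gt0 pp)) ltnS; apply: leq_trans (H p pp).
  by rewrite leq_pmulr.
rewrite p_part; apply: (@dvdn_trans (p ^ B)).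
  apply: dvdn_exp2l; apply: leq_trans (H p pp); rewrite leq_pmull //.
  by rewrite -ltnS prednK ?prime_gt0.
by apply: dvdn_exp2r; rewrite dvdn_fact // prime_gt0.
Qed.

(** A power of [a] is a rational number times a unit, and the norm of a unit is
    1 or -1. So a power of [q] is, up to sign, a power of that rational number,
    whose numerator has bounded valuations. *)
Lemma logn_galNorm (L : splittingFieldType rat) (E : {subfield L}) (C : fieldType)
    (iota : {rmorphism L -> C}) a q k x y :
  iota a = x / y -> x != 0 -> y != 0 -> valuation_bounded k x -> valuation_bounded k y ->
  galNorm 1 E a = q%:A ->
  forall p, prime p -> (p.-1 * logn p `|numq q| <= k * #|'Gal(E / 1)%g|)%N.
Proof.
move=> axy x0 y0 [d [N [e [d0 N0 xd ue hN]]]] [d' [N' [e' [d0' N0' yd ue' hN']]]] qE p pp.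
set g := #|_|.
have nat0 m : (0 < m)%N -> (m%:R : L) != 0.
  by move=> m0; rewrite -(rmorph_nat (in_alg L)) fmorph_eq0 pnatr_eq0 -lt0n.
have a0 : a != 0 by rewrite -(fmorph_eq0 iota) axy mulf_neq0 ?invr_eq0.
have q0 : q != 0.
  by apply: contraNneq a0 => q0; rewrite -(galNorm_eq0 1 E) qE q0 scale0r.
have e0' : e' != 0.
  apply: contraNneq y0 => e0; move/eqP: yd; rewrite e0 mulr0 expf_eq0 => /andP[_] //.
(* [r] cancels the integers that [x] and [y] contribute to a power of [a] *)
pose r : rat := (N' ^ d)%:R / (N ^ d')%:R.
pose eps := a ^+ (d * d') * r%:A.
have r0 : r != 0 by rewrite mulf_neq0 ?invr_eq0 // pnatr_eq0 -lt0n expn_gt0 ?N0 ?N0'.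
have rA : r%:A = (N' ^ d)%:R / (N ^ d')%:R :> L.
  by rewrite -[LHS]/(in_alg L r) rmorphM fmorphV !rmorph_nat.
have ieps : iota eps = e ^+ d' / e' ^+ d.
  rewrite /eps rA !rmorphM fmorphV !rmorphXn !rmorph_nat axy expr_div_n.
  rewrite exprM [in y ^+ _]mulnC exprM xd yd !exprMn.
  have iN m : (0 < m)%N -> (m%:R : C) != 0.
    by move=> m0; rewrite -(rmorph_nat iota) fmorph_eq0 nat0.
  have := iN N N0; have := iN N' N0' => h1 h2.
  by field; rewrite !expf_neq0.
have ueps : algunit eps.
  apply/(algunit_fmorph iota); rewrite ieps.
  by apply: algunitM; rewrite -?exprVn; apply: algunitX => //; apply: algunitV.
pose Q := q ^+ (d * d') * r ^+ g.
have nE : galNorm 1 E eps = in_alg L Q.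
  by rewrite galNormM galNormX qE galNorm_rat [RHS]rmorphM rmorphXn.
have uQ : algunit Q.
  apply/(algunit_fmorph (in_alg L)).
  suff : algunit (galNorm 1 E eps) by rewrite nE.
  split; rewrite -?galNormV.
    by apply: algint_galNorm; case: ueps.
  by apply: algint_galNorm; case: ueps.
have := algunit_rat (mulf_neq0 (expf_neq0 _ q0) (expf_neq0 _ r0)) uQ.
rewrite normrM !normrX /r normrM normfV !normr_nat expr_div_n.
have nden : `|q| = `|numq q|%N%:R / `|denq q|%N%:R.
  rewrite -{1}[q]divq_num_den normrM normfV -!intr_norm -!abszE.
  by [].
rewrite nden expr_div_n -!natrX => eqQ.
have {}eqQ : (`|numq q| ^ (d * d') * (N' ^ d) ^ g = `|denq q| ^ (d * d') * (N ^ d') ^ g)%N.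
  apply/eqP; rewrite -(eqr_nat rat) !natrM; apply/eqP.
  by move: eqQ; rewrite mulf_div => /divr1_eq; rewrite !natrX.
have num0 : (0 < `|numq q|)%N by rewrite absz_gt0 numq_eq0.
have dv : (`|numq q| ^ (d * d') %| (N ^ d') ^ g)%N.
  rewrite -(@Gauss_dvdr _ (`|denq q| ^ (d * d'))); first by rewrite -eqQ dvdn_mulr.
  by apply/coprimeXl/coprimeXr; exact: coprime_num_den.
have /(dvdn_leq_log p) := dv; rewrite !expn_gt0 N0 => /(_ isT); rewrite !lognX => le1.
rewrite -(@leq_pmul2l (d * d')) ?muln_gt0 ?d0 // mulnCA.
apply: (@leq_trans (p.-1 * (g * (d' * logn p N)))); first by rewrite leq_mul2l le1 orbT.
rewrite mulnCA [leqRHS]mulnCA.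
have -> : (k * (d * d' * g) = g * (d' * (k * d)))%N by ring.
by rewrite leq_mul2l mulnCA leq_mul2l hN ?orbT.
Qed.

Definition small_rats B : seq rat :=
  [seq x%:~R / y%:~R | x <- [seq Posz i | i <- iota 0 B.+1] ++ [seq - Posz i | i <- iota 0 B.+1],
               y <- [seq Posz i | i <- iota 0 B.+1]].

Lemma mem_small_rats B q : (`|numq q| <= B)%N -> (`|denq q| <= B)%N -> q \in small_rats B.
Proof.
move=> nB dB; apply/allpairsP; exists (numq q, denq q); split;
  rewrite -?[_.1]/(numq q) -?[_.2]/(denq q).
- rewrite mem_cat; move: nB; case: (numq q) => [k|k] kB; apply/orP; [left|right]; apply/mapP.
    by exists k; rewrite ?mem_iota.
  by exists k.+1; rewrite ?NegzE ?mem_iota.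
- by apply/mapP; exists `|denq q|%N; rewrite ?mem_iota // absz_denq.
- by rewrite divq_num_den.
Qed.

(** The minimal polynomial divides the cyclotomic one. *)
Lemma dim_cyclotomic (L : splittingFieldType rat) (z : L) n : n.-primitive_root z ->
  <<1; z>>%VS = fullv -> (\dim {:L} <= totient n)%N.
Proof.
move=> pz Ez; rewrite -Ez dim_Fadjoin dimv1 muln1 -ltnS -size_minPoly.
pose p : {poly L} := map_poly intr 'Phi_n.
have sp : size p = (totient n).+1.
  rewrite size_map_poly_id0 ?size_Cyclotomic //.
  by rewrite (monicP _) ?Cyclotomic_monic // rmorph1 oner_neq0.
rewrite -sp; apply: dvdp_leq; first by rewrite -size_poly_eq0 sp.
apply: minPoly_dvdp (root_Cyclotomic pz).
by apply/polyOverP => i; rewrite coef_map /= rpred_int.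
Qed.

(** The bound [B.+1`! ^ B] of [bounded_by_logn] for [B = 2 * (2 * e + 1)], as the
    cross ratio has two factors in the numerator and two in the denominator. *)
Definition norm_bound e := ((e.*2).*2.+3`! ^ (e.*2).*2.+2)%N.

(** Applied to [a] and to [a^-1], which is a cross ratio of the same kind,
    [logn_galNorm] bounds the numerator and the denominator of the norm. *)
Lemma galNorm_small (L : splittingFieldType rat) (E : {subfield L}) (C : fieldType)
    (iota : {rmorphism L -> C}) a q e m (t1 t2 t3 t4 : C) :
  (\dim {:L} <= e.*2.+1)%N -> (0 < m)%N ->
  t1 ^+ m = 1 -> t2 ^+ m = 1 -> t3 ^+ m = 1 -> t4 ^+ m = 1 ->
  t1 != t3 -> t2 != t4 -> t2 != t3 -> t1 != t4 ->
  iota a = (t1 - t3) * (t2 - t4) / ((t2 - t3) * (t1 - t4)) ->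
  galNorm 1 E a = q%:A -> q \in small_rats (norm_bound e).
Proof.
move=> dL m0 u1 u2 u3 u4 n13 n24 n23 n14 aE qE.
have nz (t : C) : t ^+ m = 1 -> t != 0.
  move=> tm; apply/eqP => t0; move: tm; rewrite t0 expr0n gtn_eqF //= => /esym/eqP.
  by rewrite oner_eq0.
have tm (s t : C) : s ^+ m = 1 -> t ^+ m = 1 -> s != t ->
  valuation_bounded 1 (1 - t / s) /\ 1 - t / s != 0.
  move=> sm tm st; have s0 := nz _ sm; have d1 : t / s != 1.
    by apply: contraNneq st => d1; rewrite -[t](divfK s0) d1 mul1r.
  split; last by rewrite subr_eq0 eq_sym.
  by apply: (valuation_one_sub_root m0); rewrite // expr_div_n sm tm divr1.
have [T13 Z13] := tm _ _ u1 u3 n13; have [T24 Z24] := tm _ _ u2 u4 n24.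
have [T23 Z23] := tm _ _ u2 u3 n23; have [T14 Z14] := tm _ _ u1 u4 n14.
have TX := valuation_boundedM T13 T24; have TY := valuation_boundedM T23 T14.
have X0 := mulf_neq0 Z13 Z24; have Y0 := mulf_neq0 Z23 Z14.
have aXY : iota a = ((1 - t3 / t1) * (1 - t4 / t2)) / ((1 - t3 / t2) * (1 - t4 / t1)).
  rewrite aE; move: (nz _ u1) (nz _ u2) n23 n14 => z1 z2.
  rewrite -(subr_eq0 t2 t3) -(subr_eq0 t1 t4) => d23 d14.
  by field; rewrite z1 z2 d23 d14.
have aV : iota a^-1 = ((1 - t3 / t2) * (1 - t4 / t1)) / ((1 - t3 / t1) * (1 - t4 / t2)).
  by rewrite fmorphV aXY invf_div.
have qV : galNorm 1 E a^-1 = (q^-1)%:A.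
  by rewrite galNormV qE -[in LHS]/(in_alg L q) -fmorphV.
have gB : (2 * #|'Gal(E / 1)%g| <= (e.*2).*2.+2)%N.
  by rewrite mul2n -doubleS leq_double; apply: leq_trans (card_Gal_le E) dL.
have a0 : a != 0 by rewrite -(fmorph_eq0 iota) aXY mulf_neq0 // invr_eq0.
have q0 : q != 0.
  by apply: contraNneq a0 => q0; rewrite -(galNorm_eq0 1 E) qE q0 scale0r.
apply: mem_small_rats.
  apply: bounded_by_logn => [|p pp]; first by rewrite absz_gt0 numq_eq0.
  exact: leq_trans (logn_galNorm aXY X0 Y0 TX TY qE pp) gB.
apply: bounded_by_logn => [|p pp]; first by rewrite absz_gt0 denq_neq0.
have -> : `|denq q|%N = `|numq q^-1|%N.
  rewrite -[q in q^-1]divq_num_den invf_div coprimeq_num 1?coprime_sym ?coprime_num_den //.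
  by rewrite abszM absz_sg numq_eq0 q0 mul1n.
exact: leq_trans (logn_galNorm aV Y0 X0 TY TX qV pp) gB.
Qed.

(** * Determination by X-rays *)

Lemma zeta_primitive (R : realType) n : (0 < n)%N -> n.-primitive_root (zeta R n).
Proof.
move=> n0; have [d pd dn] := prim_order_exists n0 (zeta_unity R n0).
have [E|dn_neq] := eqVneq d n; first by move: pd; rewrite E.
have d0 := prim_order_gt0 pd.
have dn' : (d < n)%N by rewrite ltn_neqAle dn_neq dvdn_leq.
have := prim_expr_order pd; rewrite /zeta cisX => /eqP.
rewrite eq_complex /= => /andP[/eqP c1 _].
pose x : R := pi * d%:R / n%:R.
have n0R : 0 < n%:R :> R by rewrite ltr0n.
have : 0 < sin x.
  apply: sin_gt0_pi; rewrite /x divr_gt0 ?mulr_gt0 ?ltr0n ?pi_gt0 //=.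
  by rewrite ltr_pdivrMr // ltr_pM2l ?pi_gt0 // ltr_nat.
move: c1; have -> : 2 * pi / n%:R *+ d = x + x.
  by rewrite -[LHS]mulr_natr /x; field; rewrite pnatr_eq0 -lt0n.
by rewrite cosD => c1; have := cos2Dsin2 x => h; nra.
Qed.

Theorem theorem17 (R : realType) (e : nat)
    (he : exists n : nat, (2 < n)%N /\ (totient n)./2 = e) :
  exists Ne : {fset rat},
    forall (n : nat) (K : cyclotomicField R n) (U : {fset R[i]}),
      (2 < n)%N -> (totient n)./2 = e ->
      #|` U| = 4%N ->
      (forall u, u \in U -> cyc_direction K u) ->
      (forall u v, u \in U -> v \in U -> u != v -> ~ parallel u v) ->
      max_real_norm K (cross_ratio_of_slopes U) \notin Ne ->
      forall L : set R[i], cyclotomic_model_sets K L ->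
        determined_by_xrays (convex_subsets L) U.
Proof.
(* 0 is the value of [max_real_norm] outside the image of the field *)
exists [fset q in 0 :: small_rats (norm_bound e)]%fset.
move=> n K U n2 en U4 dU npU nN L _ F F' cF cF' xr; apply: contrapT => neF.
move: nN; apply/negP/negPn; rewrite in_fset inE.
pose s := sort (fun u v => angle u <= angle v) U.
have ss : size s = 4%N by rewrite size_sort.
have us : uniq s by rewrite sort_uniq fset_uniq.
have sU u : (u \in s) = (u \in U) by rewrite mem_sort.
rewrite /cross_ratio_of_slopes -/s.
case: s ss us sU => [|u1 [|u2 [|u3 [|u4 []]]]] // _ us sU.
have du u : u \in [:: u1; u2; u3; u4] -> direction u by rewrite sU => /dU[].
have dn u v : u \in [:: u1; u2; u3; u4] -> v \in [:: u1; u2; u3; u4] -> u != v -> det u v != 0.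
  by move=> us' vs' uv; apply: det_neq0; [exact: du|exact: du|apply: npU; rewrite -?sU].
have [m1 m2 m3 m4] : [/\ u1 \in [:: u1; u2; u3; u4], u2 \in [:: u1; u2; u3; u4],
   u3 \in [:: u1; u2; u3; u4] & u4 \in [:: u1; u2; u3; u4]].
  by rewrite !inE !eqxx !orbT.
move: us; rewrite /= !inE !negb_or => /and4P[/and3P[n12 n13 n14] /andP[n23 n24] n34 _].
have d12 := dn _ _ m1 m2 n12; have d13 := dn _ _ m1 m3 n13; have d14 := dn _ _ m1 m4 n14.
have d23 := dn _ _ m2 m3 n23; have d24 := dn _ _ m2 m4 n24; have d34 := dn _ _ m3 m4 n34.
have xs u : u \in [:: u1; u2; u3; u4] -> eq_xray u F F' by rewrite sU; exact: xr.
have [m [A [B [m0 X0 XU]]]] := xrays_fourier cF cF' neF du m1 m2 d12 xs.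
have [t1 r1 e1] := XU _ m1; have [t2 r2 e2] := XU _ m2.
have [t3 r3 e3] := XU _ m3; have [t4 r4 e4] := XU _ m4.
have [ne13 ne24 ne23 ne14 cE] :=
  cross_ratio_unit X0 d12 d13 d14 d23 d24 d34 e1 e2 e3 e4.
rewrite /max_real_norm; case: xgetP => [q _ [a [_ aE qE]]|_]; last by rewrite eqxx.
apply/orP; right; rewrite cE in aE.
apply: (galNorm_small _ m0 r1 r2 r3 r4 ne13 ne24 ne23 ne14 aE qE).
apply: leq_trans (_ : totient n <= _)%N; last first.
  by rewrite -en -{1}(odd_double_half (totient n)) -add1n leq_add2r leq_b1.
apply: dim_cyclotomic (cyc_gen_full K).
by rewrite -(fmorph_primitive_root (cyc_emb K)) cyc_emb_gen zeta_primitive // (leq_trans _ n2).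
Qed.
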